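(* There is a function $\delta_{\mathrm{BDH}}$ (independent of $n$) such that for each integer $n\ge0$ there is a family $$\{\Phi^n_G\colon e\simeq i^n_G\mid G\text{ is a group}\}$$ of partial chain homotopies $\Phi^n_G$ defined in dimension $\le n$, between the chain maps $e,i^n_G\colon\mathbb ZBG_*\to\mathbb ZB\mathbb A^n(G)_*$, which is uniformly controlled by $\delta_{\mathrm{BDH}}$. For $k\le4$ the values of $\delta_{\mathrm{BDH}}$ are $$\delta_{\mathrm{BDH}}(0)=0,\ \delta_{\mathrm{BDH}}(1)=6,\ \delta_{\mathrm{BDH}}(2)=26,\ \delta_{\mathrm{BDH}}(3)=186,\ \delta_{\mathrm{BDH}}(4)=3410.$$
   Context: Write $g^h=hgh^{-1}$. For a group $G$ let $m(G)=\langle G,u,t\mid[h,g^u]=e,\ g^t=gg^u\text{ for all }g,h\in G\rangle$, with natural embedding $k_G\colon G\to m(G)$. Put $\mathbb A^0(G)=G$ and $\mathbb A^n(G)=m(\mathbb A^{n-1}(G))$ for $n\ge1$, and let $i^n_G\colon G\to\mathbb A^n(G)$ be the composition $k_{\mathbb A^{n-1}(G)}\circ\cdots\circ k_{\mathbb A^1(G)}\circ k_G$ ($i^0_G=\mathrm{id}_G$). $e$ denotes the trivial homomorphism. For a group $G$, $\mathbb ZBG_*$ is the chain complex with $\mathbb ZBG_n$ free abelian on the basis $\{[g_1,\ldots,g_n]\mid g_i\in G\}$ and $\partial=\sum_{i=0}^n(-1)^id_i$, where $d_0[g_1,\ldots,g_n]=[g_2,\ldots,g_n]$, $d_i[g_1,\ldots,g_n]=[g_1,\ldots,g_ig_{i+1},\ldots,g_n]$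 for $0<i<n$, $d_n[g_1,\ldots,g_n]=[g_1,\ldots,g_{n-1}]$. A homomorphism $f$ induces the chain map, also denoted $f$, with $f[g_1,\ldots,g_n]=[f(g_1),\ldots,f(g_n)]$. A partial chain homotopy $P\colon\phi\simeq\psi$ defined in dimension $\le n$, for chain maps $\phi,\psi\colon C_*\to D_*$, consists of homomorphisms $P\colon C_i\to D_{i+1}$ for $i\le n$ with $P\partial+\partial P=\psi-\phi$ on $C_i$, $i\le n$. The diameter of a chain $u=\sum n_\alpha e_\alpha$ in a based complex is $d(u)=\sum|n_\alpha|$; $d_P(k)=\max\{d(P(c))\mid c\in C_i\text{ a basis element},\ i\le k\}$ for $k\le n$. A family $\{P_A\}$ is uniformly controlled by $\delta$ (with values in $\mathbb Z_{\ge0}$) if $d_{P_A}(k)\le\delta(k)$ for all $A$ and all $k$ in the domain of $d_{P_A}$. *)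

(* Defs.v *)
From HB Require Import structures.
From mathcomp Require Import all_boot all_order all_algebra.
From mathcomp Require Import boolp zify.
From mathcomp.multinomials Require Import freeg.

Set Implicit Arguments.
Unset Strict Implicit.
Unset Printing Implicit Defensive.

Import GRing.Theory.

Local Open Scope ring_scope.

Inductive word (X : Type) : Type :=
| WGen of X
| WOne
| WMul of word X & word X
| WInv of word X.

Arguments WOne {X}.

Declare Scope word_scope.
Delimit Scope word_scope with W.
Bind Scope word_scope with word.
Notation "1" := WOne : word_scope.
Notation "v * w" := (WMul v w) : word_scope.
Notation "w ^-1" := (WInv w) : word_scope.

HB.instance Definition _ (X : Type) := gen_eqMixin (word X).
HB.instance Definition _ (X : Type) := gen_choiceMixin (word X).

(* The convention here is [g^h = h g h^-1]; MathComp's [g ^ h] on groups is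
   [h^-1 g h]. *)
Definition wconj (X : Type) (g h : word X) : word X := (h * g * h^-1)%W.
Definition wcomm (X : Type) (g h : word X) : word X := (g * h * g^-1 * h^-1)%W.

Section Presentation.

Variables (X : Type) (rel : word X -> word X -> Prop).

Local Open Scope word_scope.

(* The least congruence on words that contains [rel] and whose quotient is a
   group. *)
Inductive derivable : word X -> word X -> Prop :=
| derivable_rel v w : rel v w -> derivable v w
| derivable_refl w : derivable w w
| derivable_sym v w : derivable v w -> derivable w v
| derivable_trans u v w : derivable u v -> derivable v w -> derivable u w
| derivable_mul v v' w w' :
    derivable v v' -> derivable w w' -> derivable (v * w) (v' * w')
| derivable_inv v w : derivable v w -> derivable v^-1 w^-1
| derivable_assoc u v w : derivable (u * (v * w)) (u * v * w)
| derivable_mul1w w : derivable (1 * w) w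
| derivable_mulw1 w : derivable (w * 1) w
| derivable_mulVw w : derivable (w^-1 * w) 1
| derivable_mulwV w : derivable (w * w^-1) 1.

Definition derivableb v w : bool := `[< derivable v w >].

Lemma derivableb_refl : reflexive derivableb.
Proof. by move=> w; apply/asboolP; apply: derivable_refl. Qed.

Lemma derivableb_sym : symmetric derivableb.
Proof. by move=> v w; apply/asboolP/asboolP; apply: derivable_sym. Qed.

Lemma derivableb_trans : transitive derivableb.
Proof.
move=> v u w /asboolP uv /asboolP vw.
by apply/asboolP; apply: derivable_trans vw.
Qed.

Canonical derivable_equiv :=
  EquivRel derivableb derivableb_refl derivableb_sym derivableb_trans.

Definition presented : Type := {eq_quot derivableb}%qT.

HB.instance Definition _ := Choice.on presented.

Definition pcls (w : word X) : presented := (\pi_({eq_quot derivableb}) w)%qT.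

Lemma pclsP v w : pcls v = pcls w <-> derivable v w.
Proof.
split=> [/eqP|vw]; first by rewrite eqmodE => /asboolP.
by apply/eqP; rewrite eqmodE; apply/asboolP.
Qed.

Definition prepr (x : presented) : word X :=
  repr (x : {eq_quot derivableb}%qT).

Lemma preprK : cancel prepr pcls.
Proof. by move=> x; rewrite /pcls /prepr reprK. Qed.

Lemma prepr_pcls w : derivable (prepr (pcls w)) w.
Proof. by apply/pclsP; rewrite preprK. Qed.

Definition pmul (x y : presented) : presented := pcls (prepr x * prepr y).
Definition pinv (x : presented) : presented := pcls (prepr x)^-1.

Lemma pmulE v w : pmul (pcls v) (pcls w) = pcls (v * w).
Proof. by apply/pclsP; apply: derivable_mul; apply: prepr_pcls. Qed.

Lemma pinvE w : pinv (pcls w) = pcls w^-1.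
Proof. by apply/pclsP; apply: derivable_inv; apply: prepr_pcls. Qed.

Lemma pmulA : associative pmul.
Proof.
move=> x y z; rewrite -(preprK x) -(preprK y) -(preprK z) !pmulE.
exact/pclsP/derivable_assoc.
Qed.

Lemma pmul1g : left_id (pcls 1) pmul.
Proof. by move=> x; rewrite -(preprK x) pmulE; apply/pclsP/derivable_mul1w. Qed.

Lemma pmulg1 : right_id (pcls 1) pmul.
Proof. by move=> x; rewrite -(preprK x) pmulE; apply/pclsP/derivable_mulw1. Qed.

Lemma pmulVg : left_inverse (pcls 1) pinv pmul.
Proof.
move=> x; rewrite -(preprK x) pinvE pmulE; exact/pclsP/derivable_mulVw.
Qed.

Lemma pmulgV : right_inverse (pcls 1) pinv pmul.
Proof.
move=> x; rewrite -(preprK x) pinvE pmulE; exact/pclsP/derivable_mulwV.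
Qed.

HB.instance Definition _ := isGroup.Build presented
  pmulA pmul1g pmulg1 pmulVg pmulgV.

Lemma pclsM v w : pcls (v * w) = (pcls v * pcls w)%g.
Proof. by rewrite -pmulE. Qed.

Lemma pclsV w : pcls w^-1 = ((pcls w)^-1)%g.
Proof. by rewrite -pinvE. Qed.

Lemma pcls1 : pcls 1 = 1%g.
Proof. by []. Qed.

End Presentation.

Inductive mgen (G : Type) : Type := MBase of G | MU | MT.

Arguments MU {G}.
Arguments MT {G}.

Definition wbase (G : Type) (g : G) : word (mgen G) := WGen (MBase g).
Definition wu (G : Type) : word (mgen G) := WGen MU.
Definition wt (G : Type) : word (mgen G) := WGen MT.

Arguments wu {G}.
Arguments wt {G}.

(* [mrel_base] is the multiplication table of [G]: it makes the generators
   [wbase g] generate a quotient of [G] rather than of the free group on [G]. *)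
Inductive mrel (G : groupType) : word (mgen G) -> word (mgen G) -> Prop :=
| mrel_base (g h : G) : mrel (wbase g * wbase h)%W (wbase (g * h)%g)
| mrel_comm (g h : G) : mrel (wcomm (wbase h) (wconj (wbase g) wu)) 1%W
| mrel_conj (g : G) :
    mrel (wconj (wbase g) wt) (wbase g * wconj (wbase g) wu)%W.

Definition mgroup (G : groupType) : groupType := presented (@mrel G).

Definition kmap (G : groupType) (g : G) : mgroup G := pcls (@mrel G) (wbase g).

Lemma kmapM (G : groupType) : {morph @kmap G : g h / (g * h)%g}.
Proof.
move=> g h; rewrite /kmap -pclsM.
by apply/pclsP/derivable_sym/derivable_rel/mrel_base.
Qed.

HB.instance Definition _ (G : groupType) :=
  isMultiplicative.Build G (mgroup G) (@kmap G) (@kmapM G).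

Fixpoint Agroup (n : nat) (G : groupType) : groupType :=
  if n is n'.+1 then mgroup (Agroup n' G) else G.

Fixpoint imap (n : nat) (G : groupType) : {multiplicative G -> Agroup n G} :=
  match n return {multiplicative G -> Agroup n G} with
  | 0 => idfun
  | n'.+1 => @kmap (Agroup n' G) \o imap n' G
  end.

Definition trivial_hom (G H : groupType) : {multiplicative G -> H} :=
  @one_fun G H.

Definition basis (K : choiceType) (c : K) : {freeg K} := << (1 : int) *g c >>.

Lemma coeff_basis (K : choiceType) (c d : K) : coeff d (basis c) = (c == d)%:R.
Proof. by rewrite /basis coeffU mul1r. Qed.

Lemma freeg_basisE (K : choiceType) (x : {freeg K}) :
  x = \sum_(c <- dom x) basis c *~ coeff c x.
Proof.
rewrite -[LHS]freeg_sumE; apply: eq_bigr => c _.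
by rewrite /basis freeg_mulz intz.
Qed.

Lemma freeg_ext (K : choiceType) (M : zmodType)
    (f g : {additive {freeg K} -> M}) :
  (forall c, f (basis c) = g (basis c)) -> f =1 g.
Proof.
move=> fg x; rewrite (freeg_basisE x) !raddf_sum; apply: eq_bigr => c _.
by rewrite !raddfMz fg.
Qed.

Section FreeLift.

Variables K L : choiceType.

Definition freeg_lift (f : K -> {freeg L}) : {freeg K} -> {freeg L} := fglift f.

Lemma freeg_lift_is_additive f : zmod_morphism (freeg_lift f).
Proof. exact: lift_is_additive. Qed.

HB.instance Definition _ f :=
  GRing.isZmodMorphism.Build {freeg K} {freeg L} (freeg_lift f)
    (freeg_lift_is_additive f).

Lemma freeg_lift_basis f c : freeg_lift f (basis c) = f c.
Proof. by rewrite /freeg_lift /basis liftU scale1r. Qed.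

End FreeLift.

Record based_complex := BasedComplex {
  cell : nat -> choiceType;
  bd : forall n, {additive {freeg (cell n.+1)} -> {freeg (cell n)}};
  bd_bd : forall n x, bd n (bd n.+1 x) = 0
}.

Notation chain C n := {freeg (cell C n)}.

Record chain_map (C D : based_complex) := ChainMap {
  cmap :> forall n, {additive (chain C n) -> (chain D n)};
  cmap_bd : forall n x, cmap n (bd C n x) = bd D n (cmap n.+1 x)
}.

(* The boundary of a 0-chain is 0, so [P bd] does not occur in dimension 0. *)
Record partial_homotopy (C D : based_complex) (phi psi : chain_map C D)
    (n : nat) := PartialHomotopy {
  hmap :> forall i, (i <= n)%N -> {additive (chain C i) -> (chain D i.+1)};
  hmap_bd0 : forall (le0n : (0 <= n)%N) x,
    bd D 0 (hmap le0n x) = psi 0 x - phi 0 x;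
  hmap_bdS : forall i (lein : (i <= n)%N) (ltin : (i.+1 <= n)%N) x,
    hmap lein (bd C i x) + bd D i.+1 (hmap ltin x) = psi i.+1 x - phi i.+1 x
}.

Definition diameter (K : choiceType) (x : {freeg K}) : nat :=
  (\sum_(c <- dom x) `|coeff c x|)%N.

Definition is_maximum (S : nat -> Prop) (m : nat) : Prop :=
  S m /\ forall d, S d -> (d <= m)%N.

(* [homotopy_diameter P k d] is the equation [d_P(k) = d]. *)
Definition homotopy_diameter (C D : based_complex) (phi psi : chain_map C D)
    (n : nat) (P : partial_homotopy phi psi n) (k d : nat) : Prop :=
  is_maximum
    (fun a => exists i (lein : (i <= n)%N) (c : cell C i),
       (i <= k)%N /\ a = diameter (P i lein (basis c))) d.

Definition uniformly_controlled (I : Type) (C D : I -> based_complex)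
    (phi psi : forall A, chain_map (C A) (D A)) (n : nat)
    (P : forall A, partial_homotopy (phi A) (psi A) n)
    (delta : nat -> nat) : Prop :=
  forall A k, (k <= n)%N ->
    exists2 d, homotopy_diameter (P A) k d & (d <= delta k)%N.

Section Bar.

Variable G : groupType.

Section Face.
Local Open Scope group_scope.

(* [d_i [g_1, ..., g_{n+1}]] for [0 <= i <= n+1], given entry by entry: entries
   strictly before position [i] are kept, the entry at position [i] is
   [g_i g_{i+1}] and later entries are shifted. In particular [d_0] drops [g_1]
   and [d_{n+1}] drops [g_{n+1}]. *)
Definition face (n i : nat) (c : n.+1.-tuple G) : n.-tuple G :=
  [tuple if (j.+1 < i)%N then c`_j
         else if j.+1 == i then c`_j * c`_j.+1
         else c`_j.+1 | j < n].

Lemma nth_face n i (c : n.+1.-tuple G) j : (j < n)%N ->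
  (face i c)`_j = if (j.+1 < i)%N then c`_j
                  else if j.+1 == i then c`_j * c`_j.+1 else c`_j.+1.
Proof. by move=> lt_jn; rewrite -(tnth_nth _ _ (Ordinal lt_jn)) tnth_mktuple. Qed.

Lemma face_face n i j (c : n.+2.-tuple G) : (i <= j)%N ->
  face i (face j.+1 c) = face j (face i c).
Proof.
move=> le_ij; apply/val_inj/(@eq_from_nth _ 1); rewrite ?size_tuple// => k lt_kn.
rewrite !nth_face//; try lia.
by repeat case: ifP => ?; rewrite ?mulgA//; lia.
Qed.

End Face.

Definition bar_bd (n : nat) : {freeg (n.+1.-tuple G)} -> {freeg (n.-tuple G)} :=
  freeg_lift (fun c => \sum_(i < n.+2) basis (face i c) *~ (-1) ^+ i).

HB.instance Definition _ n := GRing.Additive.on (@bar_bd n).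

Lemma bar_bd_basis n (c : n.+1.-tuple G) :
  bar_bd (basis c) = \sum_(i < n.+2) basis (face i c) *~ (-1) ^+ i.
Proof. exact: freeg_lift_basis. Qed.

Lemma bar_bd_bd n x : bar_bd (@bar_bd n.+1 x) = 0.
Proof.
pose F (i j : nat) (c : n.+2.-tuple G) : {freeg (n.-tuple G)} :=
  basis (face j (face i c)) *~ (-1) ^+ j *~ (-1) ^+ i.
pose bb : {additive _ -> _} := @bar_bd n \o @bar_bd n.+1.
apply: (freeg_ext (f := bb) (g := \0)) => c /=.
have -> : bar_bd (bar_bd (basis c)) =
    \sum_(i < n.+3) \sum_(j < n.+2) F i j c.
  rewrite bar_bd_basis raddf_sum; apply: eq_bigr => i _.
  by rewrite raddfMz /= bar_bd_basis mulrz_suml.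
have -> : \sum_(i < n.+3) \sum_(j < n.+2) F i j c =
    \sum_(i < n.+3) \sum_(j < n.+2 | (j < i)%N) F i j c +
    \sum_(i < n.+3) \sum_(j < n.+2 | (i <= j)%N) F i j c.
  rewrite -big_split; apply: eq_bigr => i _ /=.
  rewrite (bigID (fun j : 'I_n.+2 => (j < i)%N)) /=; congr (_ + _).
  by apply: eq_bigl => j; rewrite -leqNgt.
rewrite big_ord_recl big_pred0 ?add0r; last by move=> j.
rewrite [X in _ + X](exchange_big_dep xpredT)//= -big_split big1//= => k _.
rewrite [X in _ + X]big_mkcond big_ord_recr/= leqNgt (ltn_ord k)/= addr0.
rewrite -big_mkcond -big_split big1//= => j le_jk; rewrite /F.
rewrite /bump leq0n add1n face_face// exprS mulN1r mulrNz.
by rewrite -!mulrzA [X in _ *~ X]mulrC addNr.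
Qed.

End Bar.

Section BarMap.

Variables (G H : groupType) (f : {multiplicative G -> H}).

Lemma map_face n i (c : n.+1.-tuple G) :
  map_tuple f (face i c) = face i (map_tuple f c).
Proof.
apply/val_inj/(@eq_from_nth _ 1%g) => [|k].
  by rewrite !size_tuple.
rewrite size_tuple => lt_kn; rewrite nth_face//.
rewrite (nth_map 1%g) ?size_tuple// nth_face// !(nth_map 1%g) ?size_tuple ?ltnS//.
  by rewrite -gmulfM; do 2?case: ifP.
exact: ltnW.
Qed.

Definition bar_map (n : nat) : {freeg (n.-tuple G)} -> {freeg (n.-tuple H)} :=
  freeg_lift (fun c => basis (map_tuple f c)).

HB.instance Definition _ n := GRing.Additive.on (@bar_map n).

Lemma bar_map_basis n (c : n.-tuple G) :
  bar_map (basis c) = basis (map_tuple f c).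
Proof. exact: freeg_lift_basis. Qed.

Lemma bar_map_bd n x : bar_map (bar_bd x) = bar_bd (@bar_map n.+1 x).
Proof.
pose l : {additive _ -> _} := @bar_map n \o @bar_bd G n.
pose r : {additive _ -> _} := @bar_bd H n \o @bar_map n.+1.
apply: (freeg_ext (f := l) (g := r)) => c /=.
rewrite bar_map_basis !bar_bd_basis raddf_sum; apply: eq_bigr => i _.
by rewrite raddfMz /= bar_map_basis map_face.
Qed.

End BarMap.

Definition ZB (G : groupType) : based_complex :=
  {| cell := fun n => n.-tuple G; bd := @bar_bd G; bd_bd := @bar_bd_bd G |}.

Definition ZB_map (G H : groupType) (f : {multiplicative G -> H}) :
    chain_map (ZB G) (ZB H) :=
  @ChainMap (ZB G) (ZB H) (@bar_map G H f) (@bar_map_bd G H f).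

(* Main.v *)
Require Import Defs.
From HB Require Import structures.
From mathcomp Require Import all_boot.
From mathcomp Require Import all_algebra.
From mathcomp Require Import boolp zify.
From mathcomp.multinomials Require Import freeg.

Set Implicit Arguments.
Unset Strict Implicit.
Unset Printing Implicit Defensive.

Import GRing.Theory.
Local Open Scope ring_scope.

Local Notation chains V := {freeg (seq V)}.

(** The theorem follows from one inductive step: a homomorphism [i : G -> A]
    that is null-homotopic in positive dimensions up to [n] becomes
    null-homotopic up to [n + 1] after composition with [A -> m(A)].

    Write [a = kmap] and [b = kmapU] for the two maps [g |-> g] and
    [g |-> g^u] from [A] to [M = m(A)]. Their images commute, so
    [ab : g |-> g g^u] is a homomorphism, and the relation [g^t = g g^u] says
    that [ab] is [b] conjugated by [w = t u^-1]. On chains this gives two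
    homotopies. The prism of a conjugation ([prism_homotopy]) joins [b] to
    [ab]. The Eilenberg-Zilber argument ([diag_fill_homotopy]) joins [ab] to
    the sum over all cuts of a simplex of the shuffle product of [a] on the
    front face and [b] on the back face; the two extreme cuts are [a] and [b]
    ([aw_shuffle_split]). The other cuts involve fronts and backs of positive
    and strictly smaller dimension, so after composition with [i] their sum
    is killed by the shuffle product of the given null-homotopy with [i]
    ([cuts_null]). Altogether [b ~ ab ~ a + b] on the image of [i], hence
    [a \o i ~ 0] ([mitosis_null]).

    All constructions are made on homogeneous simplices, that is, on lists of
    vertices, where the only operations are deleting a vertex and coning, and
    nearly every identity is an induction driven by
    [bdry (cone v x) = x - cone v (bdry x)]. The augmentation is kept: the
    empty list is a cell of dimension [-1]. The bar complex is the quotient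
    of homogeneous chains by translation; [normalize], which moves the first
    vertex to the identity, represents that quotient, and [to_bar] and
    [of_bar] compare it with the complex of the theorem.

    For the diameter, let [f k] bound the null-homotopy on simplices with [k]
    vertices. The prism has [k] terms, the Eilenberg-Zilber homotopy
    [2 ^ k - k - 1], and the cut with [j] front vertices contributes
    [f j * 'C(k, j)], because ['C(k, j)] counts the shuffles of the [j + 1]
    vertices produced by the null-homotopy with the [k - j + 1] of the back
    face. The recursion [controlled_step] does not mention [n] and yields
    3, 16, 97, 706 for [k] from 2 to 5, that is, in dimensions 1 to 4. Passing
    from null-homotopies to homotopies from the trivial homomorphism costs one
    more simplex, which keeps the values below 6, 26, 186, 3410. *)

(** * Homogeneous chains *)

Lemma freeg_ind (K : choiceType) (P : {freeg K} -> Prop) :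
  P 0 -> (forall x y, P x -> P y -> P (x - y)) -> (forall c, P (basis c)) ->
  forall x, P x.
Proof.
move=> P0 PB Pb x.
have PN y : P y -> P (- y) by move=> Py; rewrite -sub0r; apply: PB.
have PD y z : P y -> P z -> P (y + z).
  by move=> Py Pz; rewrite -[z]opprK; apply: PB => //; apply: PN.
have Pn y n : P y -> P (y *+ n).
  by move=> Py; elim: n => [|n IH]; rewrite ?mulr0n ?mulrS//; apply: PD.
rewrite (freeg_basisE x); elim/big_ind: _ => // c _.
case: (coeff c x) => n; rewrite ?NegzE ?mulrNz -pmulrn; last apply: PN.
  exact: Pn.
exact: Pn.
Qed.

Lemma freeg_coeffP (K : choiceType) (x y : {freeg K}) :
  (forall c, coeff c x = coeff c y) -> x = y.
Proof. by move=> xy; apply/eqP/freeg_eqP. Qed.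

Lemma freeg_liftB (K L : choiceType) (f : K -> {freeg L}) :
  {morph freeg_lift f : x y / x - y}.
Proof. exact: raddfB. Qed.

(** Identities in the abelian group [{freeg K}] are linear arithmetic on each
    coefficient. *)
Ltac freeg_abel :=
  let c := fresh "c" in
  apply: freeg_coeffP => c; rewrite ?(coeffB, coeffD, coeffN, coeff0); lia.

Section Chains.
Variable V : choiceType.

Definition cone (v : V) : chains V -> chains V :=
  freeg_lift (fun s => basis (v :: s)).
HB.instance Definition _ v := GRing.Additive.on (cone v).

Lemma cone_basis v s : cone v (basis s) = basis (v :: s).
Proof. exact: freeg_lift_basis. Qed.

Lemma coneB v : {morph cone v : x y / x - y}.
Proof. exact: raddfB. Qed.

Lemma coneD v : {morph cone v : x y / x + y}.
Proof. exact: raddfD. Qed.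

Lemma coneN v : {morph cone v : x / - x}.
Proof. exact: raddfN. Qed.

Fixpoint bdry0 (s : seq V) : chains V :=
  if s is v :: s' then basis s' - cone v (bdry0 s') else 0.

Definition bdry : chains V -> chains V := freeg_lift bdry0.
HB.instance Definition _ := GRing.Additive.on bdry.

Lemma bdry_basis s : bdry (basis s) = bdry0 s.
Proof. exact: freeg_lift_basis. Qed.

Lemma bdryB : {morph bdry : x y / x - y}.
Proof. exact: raddfB. Qed.

Lemma bdryD : {morph bdry : x y / x + y}.
Proof. exact: raddfD. Qed.

Lemma bdryN : {morph bdry : x / - x}.
Proof. exact: raddfN. Qed.

Lemma bdry_cone v x : bdry (cone v x) = x - cone v (bdry x).
Proof.
elim/freeg_ind: x => [|x y IHx IHy|s]; first by rewrite !raddf0 ?addr0 ?raddf0.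
  by rewrite !raddfB /= IHx IHy; freeg_abel.
by rewrite cone_basis !bdry_basis.
Qed.

(** The sign operator that makes Leibniz rules bilinear: it stands for the
    factor [(-1) ^ size] in a product whose left argument is a general
    chain. *)
Definition alt : chains V -> chains V :=
  freeg_lift (fun s => basis s *~ (-1) ^+ size s).
HB.instance Definition _ := GRing.Additive.on alt.

Lemma alt_basis s : alt (basis s) = basis s *~ (-1) ^+ size s.
Proof. exact: freeg_lift_basis. Qed.

Lemma altB : {morph alt : x y / x - y}.
Proof. exact: raddfB. Qed.

Lemma altN : {morph alt : x / - x}.
Proof. exact: raddfN. Qed.

Lemma alt_cone v x : alt (cone v x) = - cone v (alt x).
Proof.
elim/freeg_ind: x => [|x y IHx IHy|s]; first by rewrite !raddf0.
  by rewrite !raddfB /= IHx IHy; freeg_abel.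
by rewrite cone_basis !alt_basis raddfMz /= cone_basis exprS mulN1r mulrNz.
Qed.

Lemma alt_nil : alt (basis [::]) = basis [::].
Proof. by rewrite alt_basis. Qed.

Lemma alt_sign s : {b : bool | alt (basis s) = basis s *~ (-1) ^+ b}.
Proof. by exists (odd (size s)); rewrite alt_basis signr_odd. Qed.

Lemma altK : involutive alt.
Proof.
move=> x; elim/freeg_ind: x => [|x y IHx IHy|s]; first by rewrite !raddf0.
  by rewrite !altB IHx IHy.
by rewrite alt_basis raddfMz /= alt_basis -mulrzA -expr2 sqrr_sign mulr1z.
Qed.

Lemma bdry_alt x : bdry (alt x) = - alt (bdry x).
Proof.
elim/freeg_ind: x => [|x y IHx IHy|s]; first by rewrite !raddf0.
  by rewrite !raddfB /= IHx IHy; freeg_abel.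
elim: s => [|v s IH]; first by rewrite alt_nil bdry_basis raddf0 oppr0.
rewrite -cone_basis alt_cone bdry_cone raddfN raddfB /= bdry_cone IH alt_cone.
by rewrite raddfN /=; freeg_abel.
Qed.

End Chains.

Section Push.
Variables (V W : choiceType) (f : V -> W).

Definition push : chains V -> chains W :=
  freeg_lift (fun s => basis (map f s)).
HB.instance Definition _ := GRing.Additive.on push.

Lemma push_basis s : push (basis s) = basis (map f s).
Proof. exact: freeg_lift_basis. Qed.

Lemma pushB : {morph push : x y / x - y}.
Proof. exact: raddfB. Qed.

Lemma pushD : {morph push : x y / x + y}.
Proof. exact: raddfD. Qed.

Lemma pushN : {morph push : x / - x}.
Proof. exact: raddfN. Qed.

Lemma push_cone v x : push (cone v x) = cone (f v) (push x).
Proof.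
elim/freeg_ind: x => [|x y IHx IHy|s]; first by rewrite !raddf0.
  by rewrite !raddfB /= IHx IHy.
by rewrite cone_basis !push_basis cone_basis.
Qed.

Lemma push_bdry x : push (bdry x) = bdry (push x).
Proof.
elim/freeg_ind: x => [|x y IHx IHy|s]; first by rewrite !raddf0.
  by rewrite !raddfB /= IHx IHy.
elim: s => [|v s IH]; first by rewrite push_basis !bdry_basis raddf0.
by rewrite -cone_basis push_cone !bdry_cone raddfB /= push_cone IH.
Qed.

Lemma push_alt x : push (alt x) = alt (push x).
Proof.
elim/freeg_ind: x => [|x y IHx IHy|s]; first by rewrite !raddf0.
  by rewrite !raddfB /= IHx IHy.
by rewrite push_basis !alt_basis raddfMz /= push_basis size_map.
Qed.
End Push.

Lemma push_comp (U V W : choiceType) (f : V -> W) (g : U -> V) x :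
  push f (push g x) = push (f \o g) x.
Proof.
elim/freeg_ind: x => [|x y IHx IHy|s]; first by rewrite !raddf0.
  by rewrite !raddfB /= IHx IHy.
by rewrite !push_basis map_comp.
Qed.

Lemma eq_push (V W : choiceType) (f g : V -> W) : f =1 g -> push f =1 push g.
Proof.
move=> fg x; elim/freeg_ind: x => [|x y IHx IHy|s]; first by rewrite !raddf0.
  by rewrite !raddfB /= IHx IHy.
by rewrite !push_basis (eq_map fg).
Qed.

(** * The prism between two vertex maps *)

Section Prism.
Variables (V W : choiceType) (f g : V -> W).

Fixpoint prism0 (s : seq V) : chains W :=
  if s is v :: s' then cone (f v) (push g (basis (v :: s')) - prism0 s') else 0.

Definition prism : chains V -> chains W := freeg_lift prism0.
HB.instance Definition _ := GRing.Additive.on prism.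

Lemma prism_basis s : prism (basis s) = prism0 s.
Proof. exact: freeg_lift_basis. Qed.

Lemma prism_cone v x :
  prism (cone v x) = cone (f v) (push g (cone v x) - prism x).
Proof.
elim/freeg_ind: x => [|x y IHx IHy|s]; first by rewrite !raddf0 ?addr0 ?raddf0.
  by rewrite !raddfB /= IHx IHy !raddfB /=; freeg_abel.
by rewrite cone_basis !prism_basis /=.
Qed.

Lemma prism_homotopy x :
  bdry (prism x) + prism (bdry x) = push g x - push f x.
Proof.
elim/freeg_ind: x => [|x y IHx IHy|s]; first by rewrite !raddf0 ?addr0 ?raddf0.
  by rewrite !raddfB /= addrACA -opprD IHx IHy; freeg_abel.
elim: s => [|v s IH].
  by rewrite !bdry_basis prism_basis /= !push_basis !raddf0 addr0 subrr.
rewrite -cone_basis prism_cone !bdry_cone [prism (_ - _)]raddfB /= prism_cone.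
rewrite [bdry (_ - _)]raddfB /= (canRL (addrK _) IH) -push_bdry bdry_cone.
rewrite [push g (_ - _)]raddfB /= !push_cone.
rewrite !coneB; freeg_abel.
Qed.

End Prism.

(** This specializes to equivariance: translations on both sides preserve the
    prism when the vertex maps are equivariant. *)
Lemma prism_push (V V' W W' : choiceType) (f g : V -> W) (f' g' : V' -> W')
    (p : V -> V') (q : W -> W') :
    (forall v, f' (p v) = q (f v)) -> (forall v, g' (p v) = q (g v)) ->
  forall x, prism f' g' (push p x) = push q (prism f g x).
Proof.
move=> ff' gg' x; elim/freeg_ind: x => [|x y IHx IHy|s].
- by rewrite !raddf0.
- by rewrite !raddfB /= IHx IHy.
elim: s => [|v s IH]; first by rewrite push_basis !prism_basis raddf0.
rewrite -cone_basis push_cone !prism_cone IH -(push_cone p) ff'.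
rewrite (push_cone q) pushB !push_comp.
by rewrite (@eq_push _ _ (g' \o p) (q \o g) gg').
Qed.

(** * The shuffle product *)

Record biadditive (K L M : choiceType)
    (B : {freeg K} -> {freeg L} -> {freeg M}) : Prop := Biadditive {
  biaddBl : forall y, {morph B^~ y : x x' / x - x'};
  biaddBr : forall x, {morph B x : y y' / y - y'}
}.

Section Biadditive.
Variables (K L M : choiceType) (B : {freeg K} -> {freeg L} -> {freeg M}).
Hypothesis addB : biadditive B.

Lemma biadd0l y : B 0 y = 0.
Proof. by rewrite -(subrr 0) (biaddBl addB) subrr. Qed.

Lemma biadd0r x : B x 0 = 0.
Proof. by rewrite -(subrr 0) (biaddBr addB) subrr. Qed.

Lemma biaddNl x y : B (- x) y = - B x y.
Proof. by rewrite -sub0r (biaddBl addB) biadd0l sub0r. Qed.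

End Biadditive.

Section Shuffle.
Variables (V W U : choiceType) (m : V -> W -> U).

(** The sum over the lattice paths from the first to the last pair of vertices
    of the grid [s * t], with vertices labelled by [m]; the first step goes
    either along [s] or along [t]. The values on empty lists are not symmetric:
    a point times the empty cell vanishes, while the empty cell times a point
    is the empty cell. With this choice the product of two points is a case of
    the recursion, and the Leibniz rule [shuffle_bdry] holds without exception
    for augmented boundaries. *)
Fixpoint shuffle0 (s : seq V) : seq W -> chains U :=
  if s is v :: s' then
    fix shuffle_s t := if t is w :: t' then
      cone (m v w) (shuffle0 s' t + shuffle_s t' *~ (-1) ^+ size s')
    else 0
  else fun t => if size t == 1%N then basis [::] else 0.

Definition shuffle (x : chains V) (y : chains W) : chains U :=
  freeg_lift (fun s => freeg_lift (shuffle0 s) y) x.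

Lemma shuffle_basis s t : shuffle (basis s) (basis t) = shuffle0 s t.
Proof. by rewrite /shuffle !freeg_lift_basis. Qed.

Lemma shuffle_biadditive : biadditive shuffle.
Proof.
split=> [y x x'|x y y']; first by rewrite /shuffle raddfB.
rewrite /shuffle; elim/freeg_ind: x => [|x x' IHx IHx'|s].
- by rewrite !raddf0 ?addr0.
- by rewrite !(freeg_liftB _ x x') IHx IHx'; freeg_abel.
by rewrite !freeg_lift_basis freeg_liftB.
Qed.
Let shB := shuffle_biadditive.

Lemma shuffle_cone v w x y :
  shuffle (cone v x) (cone w y) =
  cone (m v w) (shuffle x (cone w y) - shuffle (alt (cone v x)) y).
Proof.
elim/freeg_ind: x => [|x x' IHx IHx'|s].
- by rewrite !raddf0 !(biadd0l shB) subrr raddf0.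
- rewrite !(coneB, altB) !(biaddBl shB) IHx IHx' !coneB.
  by freeg_abel.
elim/freeg_ind: y => [|y y' IHy IHy'|t].
- by rewrite !raddf0 !(biadd0r shB) subrr raddf0.
- by rewrite !(coneB, altB) !(biaddBr shB) IHy IHy' !coneB; freeg_abel.
rewrite !cone_basis alt_basis /= exprS mulN1r mulrNz (biaddNl shB) opprK.
rewrite !shuffle_basis /=; congr (cone _ (_ + _)).
by rewrite /shuffle raddfMz /= !freeg_lift_basis.
Qed.

Lemma shuffle_nilr x : shuffle x (basis [::]) = 0.
Proof.
elim/freeg_ind: x => [|x y IHx IHy|[|v s]].
- by rewrite (biadd0l shB).
- by rewrite (biaddBl shB) IHx IHy subrr.
- by rewrite shuffle_basis.
by rewrite shuffle_basis.
Qed.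

(** The empty cell times [y] is the augmentation of [y], which vanishes on
    boundaries of cells of positive dimension; the boundary of a point is the
    empty cell, on which it vanishes by convention. *)
Lemma shuffle_nill w x :
  shuffle (basis [::]) (bdry (cone w x)) = 0.
Proof.
elim/freeg_ind: x => [|x y IHx IHy|[|v s]].
- by rewrite !raddf0 (biadd0r shB).
- by rewrite !(coneB, bdryB) (biaddBr shB) IHx IHy subrr.
- by rewrite cone_basis bdry_basis /= raddf0 subr0 shuffle_nilr.
rewrite bdry_cone bdry_basis /= coneB !(biaddBr shB) cone_basis.
rewrite !shuffle_basis.
have -> : shuffle (basis [::]) (cone w (cone v (bdry0 s))) = 0.
  elim/freeg_ind: (bdry0 s) => [|x y IHx IHy|t].
  - by rewrite !raddf0 (biadd0r shB).
  - by rewrite !coneB (biaddBr shB) IHx IHy subrr.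
  by rewrite !cone_basis shuffle_basis.
by rewrite subr0 subrr.
Qed.

(** Removing the first pair of vertices leaves the products of one factor with
    the other one truncated, which are the first faces on the right-hand side;
    the truncation of both factors occurs twice with opposite signs. *)
Lemma shuffle_bdry x y :
  bdry (shuffle x y) = shuffle (bdry x) y - shuffle (alt x) (bdry y).
Proof.
elim/freeg_ind: x => [|x x' IHx IHx'|s].
- by rewrite !raddf0 !(biadd0l shB) raddf0 subrr.
- by rewrite !(bdryB, altB) !(biaddBl shB) bdryB IHx IHx'; freeg_abel.
elim/freeg_ind: y => [|y y' IHy IHy'|t].
- by rewrite !raddf0 !(biadd0r shB) raddf0 subrr.
- by rewrite !(bdryB, altB) !(biaddBr shB) bdryB IHy IHy'; freeg_abel.
elim: s t => [t|v s IHs].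
  rewrite bdry_basis (biadd0l shB) sub0r alt_nil.
  case: t => [|w t].
    by rewrite bdry_basis !shuffle_nilr raddf0 (biadd0r shB) oppr0.
  rewrite -cone_basis shuffle_nill oppr0 cone_basis shuffle_basis /=.
  by case: ifP => _; rewrite ?bdry_basis ?raddf0.
elim=> [|w t IHt].
  by rewrite !shuffle_nilr bdry_basis (biadd0r shB) raddf0 subr0.
(* [alt] acts on a basis element by a sign, so the induction hypothesis on
   [t] remains true with [alt] inserted, as [shuffle_cone] requires. *)
have IHt' : bdry (shuffle (alt (basis (v :: s))) (basis t)) =
    shuffle (bdry (alt (basis (v :: s)))) (basis t)
    - shuffle (basis (v :: s)) (bdry (basis t)).
  rewrite -[X in shuffle X (bdry _)]altK.
  case: (alt_sign (v :: s)) => -[] eb; rewrite [X in shuffle X (basis t)]eb.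
    have -> : bdry (alt (basis (v :: s))) = - bdry (basis (v :: s)).
      by rewrite eb mulrN1z raddfN.
    have -> : alt (alt (basis (v :: s))) = - alt (basis (v :: s)).
      by rewrite {1}eb mulrN1z raddfN.
    by rewrite mulrN1z !(biaddNl shB) raddfN /= IHt; freeg_abel.
  by rewrite {1 2}eb !mulr1z IHt.
have {IHt'} IHt' : bdry (shuffle (cone v (alt (basis s))) (basis t)) =
    shuffle (bdry (cone v (alt (basis s)))) (basis t)
    + shuffle (cone v (basis s)) (bdry (basis t)).
  rewrite -cone_basis alt_cone (biaddNl shB) !bdryN (biaddNl shB) in IHt'.
  by rewrite -[LHS]opprK IHt'; freeg_abel.
move: (IHs (w :: t)) => {}IHs.
rewrite -!cone_basis in IHs *.
rewrite shuffle_cone !bdry_cone !(biaddBl shB) !(biaddBr shB).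
rewrite !alt_cone !(biaddNl shB) !shuffle_cone !alt_cone altK.
rewrite opprK bdryD IHs IHt' !bdry_cone bdry_alt.
rewrite !(biaddBr shB) !(biaddBl shB) ?coneN ?(biaddNl shB).
by rewrite !(coneB, coneD, coneN); freeg_abel.
Qed.

(** A grid of width one has a single lattice path. *)
Lemma shuffle1l v w t :
  shuffle (basis [:: v]) (basis (w :: t)) = basis (map (m v) (w :: t)).
Proof.
rewrite shuffle_basis; elim: t w => [|x t IH] w /=.
  by rewrite mul0rz addr0 cone_basis.
by rewrite add0r expr0 mulr1z -[RHS]cone_basis -IH.
Qed.

Lemma shuffle1r w s :
  shuffle (basis s) (basis [:: w]) = basis (map (m^~ w) s).
Proof.
rewrite shuffle_basis; elim: s => [//|v s IH] /=.
by rewrite mul0rz addr0 IH cone_basis.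
Qed.

End Shuffle.

Lemma shuffle_push (V V' W W' U U' : choiceType) (m : V -> W -> U)
    (m' : V' -> W' -> U') (f : V -> V') (g : W -> W') (h : U -> U') :
  (forall v w, m' (f v) (g w) = h (m v w)) -> forall x y,
  shuffle m' (push f x) (push g y) = push h (shuffle m x y).
Proof.
have shB := shuffle_biadditive m; have shB' := shuffle_biadditive m'.
move=> mm' x y.
elim/freeg_ind: x => [|x x' IHx IHx'|s].
- by rewrite !raddf0 (biadd0l shB) (biadd0l shB') raddf0.
- by rewrite pushB (biaddBl shB) (biaddBl shB') IHx IHx' pushB.
elim/freeg_ind: y => [|y y' IHy IHy'|t].
- by rewrite !raddf0 (biadd0r shB) (biadd0r shB') raddf0.
- by rewrite pushB (biaddBr shB) (biaddBr shB') IHy IHy' pushB.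
elim: s t => [|v s IHs] t.
  rewrite !push_basis !shuffle_basis /= size_map.
  by case: ifP => _; rewrite ?push_basis ?raddf0.
elim: t => [|w t IHt].
  by rewrite !push_basis !shuffle_nilr raddf0.
have IHt' : shuffle m' (alt (push f (basis (v :: s)))) (push g (basis t)) =
    push h (shuffle m (alt (basis (v :: s))) (basis t)).
  rewrite -push_alt; case: (alt_sign (v :: s)) => -[] ->.
    by rewrite mulrN1z pushN (biaddNl shB) (biaddNl shB') IHt pushN.
  by rewrite mulr1z IHt.
move: (IHs (w :: t)) => {}IHs.
rewrite -!cone_basis in IHs IHt' *.
rewrite shuffle_cone (push_cone h) pushB -IHs -IHt' -mm' !push_cone.
by rewrite shuffle_cone.
Qed.

(** * Cutting simplices into front and back faces *)

Section Cuts.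
Variables (V M : choiceType).
Implicit Types B : chains V -> chains V -> {freeg M}.

(** The Alexander-Whitney diagonal, with a biadditive [B] in place of the tensor
    product: front and back share the vertex at which the simplex is cut. *)
Definition cuts0 B (s : seq V) : {freeg M} :=
  \sum_(p < size s) B (basis (take p.+1 s)) (basis (drop p s)).

Definition cuts B : chains V -> {freeg M} := freeg_lift (cuts0 B).
HB.instance Definition _ B := GRing.Additive.on (cuts B).

Lemma cuts_basis B s : cuts B (basis s) = cuts0 B s.
Proof. exact: freeg_lift_basis. Qed.

Lemma cutsB B : {morph cuts B : x y / x - y}.
Proof. exact: raddfB. Qed.

Lemma cuts_cone B v x : biadditive B ->
  cuts B (cone v x) =
  B (basis [:: v]) (cone v x) + cuts (fun y z => B (cone v y) z) x.
Proof.
move=> addB; elim/freeg_ind: x => [|x y IHx IHy|s].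
- by rewrite !raddf0 (biadd0r addB) addr0.
- by rewrite coneB !cutsB IHx IHy (biaddBr addB); freeg_abel.
rewrite cone_basis !cuts_basis /cuts0 /= big_ord_recl take0 drop0.
by congr (_ + _); apply: eq_bigr => p _; rewrite cone_basis.
Qed.

Lemma biadditive_cone B v : biadditive B ->
  biadditive (fun y z => B (cone v y) z).
Proof.
by move=> addB; split=> x y z; rewrite ?coneB ?(biaddBl addB) ?(biaddBr addB).
Qed.

(** The diagonal is a chain map: the other faces of front and back are cuts of
    faces, and deleting the shared vertex from the front cancels deleting it
    from the back at the preceding cut. Only the two outermost cells, whose
    front or back is empty, remain. *)
Lemma cuts_bdry B x : biadditive B ->
  cuts (fun y z => B (bdry y) z - B (alt y) (bdry z)) x =
  cuts B (bdry x) + B (basis [::]) x - B (alt x) (basis [::]).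
Proof.
pose dB B := fun y z => B (bdry y) z - B (alt y) (bdry z) : {freeg M}.
have adddB B' : biadditive B' -> biadditive (dB B').
  move=> addB'; rewrite /dB; split=> z y y' /=.
    by rewrite bdryB altB !(biaddBl addB'); freeg_abel.
  by rewrite bdryB !(biaddBr addB'); freeg_abel.
rewrite -/(dB B) => addB; elim/freeg_ind: x => [|x y IHx IHy|s].
- by rewrite !raddf0 (biadd0l addB) (biadd0r addB) ?(subr0, addr0).
- rewrite cutsB IHx IHy bdryB altB cutsB (biaddBl addB) (biaddBr addB).
  by freeg_abel.
elim: s B addB => [|v s IH] B addB.
  by rewrite alt_nil !bdry_basis /= cuts_basis /cuts0 big_ord0 raddf0 add0r subrr.
have addBv := biadditive_cone v addB.
rewrite -cone_basis (cuts_cone _ _ (adddB _ addB)) /dB alt_cone bdry_cone.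
rewrite cutsB (cuts_cone _ _ addB) bdry_basis /= raddf0 subr0.
rewrite alt_basis expr1 mulrN1z (biaddNl addB).
have -> :
    cuts (fun y z => B (bdry (cone v y)) z - B (alt (cone v y)) (bdry z))
      (basis s) =
    cuts B (basis s) - cuts (dB (fun y z => B (cone v y) z)) (basis s).
  rewrite !cuts_basis /cuts0 -sumrB; apply: eq_bigr => p _.
  rewrite /dB bdry_cone alt_cone (biaddBl addB) (biaddNl addB).
  freeg_abel.
rewrite (IH (fun y z => B (cone v y) z) addBv) (biaddBr addB).
rewrite !(biaddNl addB) !cone_basis.
freeg_abel.
Qed.
End Cuts.

Lemma cuts_push (V V' M M' : choiceType) (B : chains V -> chains V -> {freeg M})
    (B' : chains V' -> chains V' -> {freeg M'}) (f : V -> V')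
    (h : {additive {freeg M} -> {freeg M'}}) :
  (forall s t,
    B' (basis (map f s)) (basis (map f t)) = h (B (basis s) (basis t))) ->
  forall x, cuts B' (push f x) = h (cuts B x).
Proof.
move=> BB' x; elim/freeg_ind: x => [|x y IHx IHy|s]; first by rewrite !raddf0.
  by rewrite pushB !cutsB raddfB IHx IHy.
rewrite push_basis !cuts_basis /cuts0 raddf_sum size_map.
by apply: eq_bigr => p _; rewrite -map_take -map_drop BB'.
Qed.

(** * The Eilenberg-Zilber homotopy on the diagonal *)

Section Diagonal.
Variables (V U : choiceType) (m : V -> V -> U).
Let shB := shuffle_biadditive m.

(** The value on the empty cell that turns [cuts (shuffle m)], which vanishes
    there, into an augmentation-preserving chain map [aw_shuffle]. *)
Definition augm : chains V -> chains U :=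
  freeg_lift (fun s => if s is [::] then basis [::] else 0).
HB.instance Definition _ := GRing.Additive.on augm.

Lemma augm_cone v x : augm (cone v x) = 0.
Proof.
elim/freeg_ind: x => [|x y IHx IHy|s]; first by rewrite !raddf0.
  by rewrite coneB raddfB /= IHx IHy subrr.
by rewrite cone_basis /augm freeg_lift_basis.
Qed.

Definition aw_shuffle x := cuts (shuffle m) x + augm x.

Lemma aw_shuffleB : {morph aw_shuffle : x y / x - y}.
Proof. by move=> x y; rewrite /aw_shuffle cutsB raddfB /=; freeg_abel. Qed.

Lemma aw_shuffle_bdry x : bdry (aw_shuffle x) = aw_shuffle (bdry x).
Proof.
elim/freeg_ind: x => [|x y IHx IHy|s].
- by rewrite /aw_shuffle ?raddf0 ?addr0 ?raddf0.
- by rewrite aw_shuffleB !bdryB IHx IHy aw_shuffleB.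
have bdry_cuts : bdry (cuts (shuffle m) (basis s)) =
   cuts (fun y z => shuffle m (bdry y) z - shuffle m (alt y) (bdry z)) (basis s).
  rewrite !cuts_basis /cuts0 raddf_sum; apply: eq_bigr => p _.
  by rewrite /= shuffle_bdry.
rewrite /aw_shuffle bdryD bdry_cuts (cuts_bdry _ shB) shuffle_nilr subr0 -!addrA.
congr (_ + _); case: s {bdry_cuts} => [|v s].
  by rewrite shuffle_nilr /augm freeg_lift_basis !bdry_basis /= raddf0 addr0.
rewrite -cone_basis augm_cone raddf0 addr0 cone_basis shuffle_basis /=.
rewrite bdry_basis /= raddfB /= augm_cone subr0 /augm freeg_lift_basis.
by case: s.
Qed.

Lemma aw_shuffle_cone v x :
  aw_shuffle (cone v x) = cone (m v v) (push (m v) x) +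
    cuts (fun y z => shuffle m (cone v y) z) x.
Proof.
rewrite /aw_shuffle augm_cone addr0 (cuts_cone _ _ shB); congr (_ + _).
elim/freeg_ind: x => [|x y IHx IHy|s].
- by rewrite !raddf0 (biadd0r shB).
- by rewrite !coneB (biaddBr shB) pushB coneB IHx IHy.
by rewrite push_basis !cone_basis shuffle1l.
Qed.

(** The diagonal simplex and the simplices of [aw_shuffle] all lie in the grid
    [s * s], whose smallest vertex is the pair of first vertices. The homotopy
    cones off, from that vertex, the part of the difference that does not
    already start there: the cuts after the first vertex, and the homotopy on
    the face opposite to it. *)
Fixpoint diag_fill0 (s : seq V) : chains U :=
  if s is v :: s' then
    - cone (m v v) (cuts (fun y z => shuffle m (cone v y) z) (basis s')
                    + diag_fill0 s')
  else 0.

Definition diag_fill : chains V -> chains U := freeg_lift diag_fill0.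
HB.instance Definition _ := GRing.Additive.on diag_fill.

Lemma diag_fillB : {morph diag_fill : x y / x - y}.
Proof. exact: raddfB. Qed.

Lemma diag_fill_basis s : diag_fill (basis s) = diag_fill0 s.
Proof. exact: freeg_lift_basis. Qed.

Lemma diag_fill_cone v x :
  diag_fill (cone v x) =
  - cone (m v v) (cuts (fun y z => shuffle m (cone v y) z) x + diag_fill x).
Proof.
elim/freeg_ind: x => [|x y IHx IHy|s].
- by rewrite !raddf0 addr0 !raddf0.
- by rewrite coneB !diag_fillB IHx IHy cutsB !(coneB, coneD); freeg_abel.
by rewrite cone_basis !diag_fill_basis.
Qed.

Lemma diag_fill_homotopy x :
  bdry (diag_fill x) + diag_fill (bdry x) =
  push (fun v => m v v) x - aw_shuffle x.
Proof.
elim/freeg_ind: x => [|x y IHx IHy|s].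
- by rewrite /aw_shuffle !raddf0 !addr0 subr0.
- rewrite !(bdryB, diag_fillB) aw_shuffleB pushB.
  rewrite -[bdry (diag_fill x)](addrK (diag_fill (bdry x))) IHx.
  rewrite -[bdry (diag_fill y)](addrK (diag_fill (bdry y))) IHy.
  by freeg_abel.
elim: s => [|v s IH].
  rewrite bdry_basis diag_fill_basis /= !raddf0 addr0 push_basis /=.
  by rewrite /aw_shuffle cuts_basis /cuts0 big_ord0 add0r /augm freeg_lift_basis subrr.
have T1 := aw_shuffle_bdry (cone v (basis s)).
rewrite aw_shuffle_cone bdryD !bdry_cone aw_shuffleB aw_shuffle_cone in T1.
set C := cuts _ in T1; set c := cone (m v v) in T1.
rewrite -cone_basis diag_fill_cone bdry_cone bdryN bdry_cone bdryD -/C -/c.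
rewrite diag_fillB diag_fill_cone -/C -/c aw_shuffle_cone -/C -/c.
rewrite -[bdry (diag_fill _)](addrK (diag_fill (bdry (basis s)))) IH.
have -> : bdry (C (basis s)) = aw_shuffle (basis s)
    - (c (push (m v) (bdry (basis s))) + C (bdry (basis s)))
    - push (m v) (basis s) + c (bdry (push (m v) (basis s))).
  by rewrite -T1; freeg_abel.
rewrite push_cone -/c -push_bdry /c !(coneB, coneD) ?coneN; freeg_abel.
Qed.
End Diagonal.

(** * Homogeneous chains modulo translation *)

Lemma push_id (V : choiceType) (x : chains V) : push id x = x.
Proof.
elim/freeg_ind: x => [|x y IHx IHy|s]; first by rewrite raddf0.
  by rewrite pushB IHx IHy.
by rewrite push_basis map_id.
Qed.

Lemma diag_fill_push (V V' U U' : choiceType) (m : V -> V -> U)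
    (m' : V' -> V' -> U') (p : V -> V') (q : U -> U') :
  (forall v w, m' (p v) (p w) = q (m v w)) -> forall x,
  diag_fill m' (push p x) = push q (diag_fill m x).
Proof.
move=> mm' x; elim/freeg_ind: x => [|x y IHx IHy|s]; first by rewrite !raddf0.
  by rewrite pushB !diag_fillB IHx IHy pushB.
elim: s => [|v s IH]; first by rewrite push_basis !diag_fill_basis /= raddf0.
rewrite -cone_basis push_cone !diag_fill_cone pushN push_cone pushD mm' IH.
congr (- cone _ (_ + _)); apply: cuts_push => y z /=.
by rewrite -!push_basis -push_cone (shuffle_push mm').
Qed.

Section Translation.
Variable G : groupType.

Definition translate (g : G) : chains G -> chains G := push (fun v => g * v)%g.
HB.instance Definition _ g := GRing.Additive.on (translate g).

(** Two chains are equal modulo translation exactly when they have the same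
    normalization. *)
Definition normalize : chains G -> chains G :=
  freeg_lift (fun s => basis (map (fun v => (head 1 s)^-1 * v)%g s)).
HB.instance Definition _ := GRing.Additive.on normalize.

Lemma normalizeB : {morph normalize : x y / x - y}.
Proof. exact: raddfB. Qed.

Lemma normalizeD : {morph normalize : x y / x + y}.
Proof. exact: raddfD. Qed.

Lemma normalize_basis s :
  normalize (basis s) = translate (head 1 s)^-1%g (basis s).
Proof. by rewrite /normalize freeg_lift_basis /translate push_basis. Qed.

Lemma normalize_translate g x : normalize (translate g x) = normalize x.
Proof.
elim/freeg_ind: x => [|x y IHx IHy|s]; first by rewrite !raddf0.
  by rewrite /translate pushB !normalizeB IHx IHy.
rewrite {1}/translate push_basis /normalize !freeg_lift_basis; congr basis.
case: s => // v s /=; rewrite -map_comp; congr cons.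
  by rewrite !mulVg.
by apply: eq_map => x /=; rewrite invgM -mulgA mulKg.
Qed.
End Translation.

Definition descends (G H : groupType) (f : chains G -> chains H) : Prop :=
  forall x y, normalize x = normalize y -> normalize (f x) = normalize (f y).

Lemma descendsP (G H : groupType) (f : chains G -> chains H) :
  {morph f : x y / x - y} ->
  (forall g s, normalize (f (translate g (basis s))) = normalize (f (basis s))) ->
  descends f.
Proof.
move=> fB f_inv.
have f0 : f 0 = 0 by rewrite -(subrr 0) fB subrr.
suff fE x : normalize (f (normalize x)) = normalize (f x).
  by move=> x y xy; rewrite -fE xy fE.
elim/freeg_ind: x => [|x y IHx IHy|s]; first by rewrite raddf0.
  by rewrite normalizeB !fB !normalizeB IHx IHy.
by rewrite normalize_basis f_inv.
Qed.

Lemma translate_push (G H : groupType) (f : G -> H) :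
  {morph f : x y / (x * y)%g} -> forall g x,
  push f (translate g x) = translate (f g) (push f x).
Proof.
by move=> fM g x; rewrite /translate !push_comp; apply: eq_push => v /=.
Qed.

Lemma push_descends (G H : groupType) (f : G -> H) :
  {morph f : x y / (x * y)%g} -> descends (push f).
Proof.
move=> fM; apply: descendsP => [|g s]; first exact: pushB.
by rewrite translate_push// normalize_translate.
Qed.

Section PositiveDimension.
Variable V : choiceType.

(** The bar complex has one vertex and a zero boundary in dimension one, so its
    part of positive dimension is a direct summand; [posdim] is the projection,
    which commutes with the boundary only modulo translation
    ([posdim_bdry]). *)
Definition posdim : chains V -> chains V :=
  freeg_lift (fun s => if (1 < size s)%N then basis s else 0).
HB.instance Definition _ := GRing.Additive.on posdim.

Lemma posdimB : {morph posdim : x y / x - y}.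
Proof. exact: raddfB. Qed.

Lemma posdim_basis s :
  posdim (basis s) = if (1 < size s)%N then basis s else 0.
Proof. exact: freeg_lift_basis. Qed.

Lemma posdim_cone2 v w x : posdim (cone v (cone w x)) = cone v (cone w x).
Proof.
elim/freeg_ind: x => [|x y IHx IHy|s]; first by rewrite !raddf0.
  by rewrite !coneB posdimB IHx IHy.
by rewrite !cone_basis posdim_basis.
Qed.
End PositiveDimension.

Lemma push_posdim (V W : choiceType) (f : V -> W) x :
  push f (posdim x) = posdim (push f x).
Proof.
elim/freeg_ind: x => [|x y IHx IHy|s]; first by rewrite !raddf0.
  by rewrite posdimB !pushB IHx IHy posdimB.
rewrite push_basis !posdim_basis size_map.
by case: ifP; rewrite ?push_basis ?raddf0.
Qed.

Lemma posdim_descends (G : groupType) : descends (@posdim G).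
Proof.
apply: descendsP => [|g s]; first exact: posdimB.
by rewrite /translate -push_posdim normalize_translate.
Qed.

Lemma posdim_bdry (G : groupType) (x : chains G) :
  normalize (posdim (bdry x)) = normalize (bdry (posdim x)).
Proof.
elim/freeg_ind: x => [|x y IHx IHy|[|a [|b [|c s]]]].
- by rewrite !raddf0.
- by rewrite !(bdryB, posdimB) !normalizeB IHx IHy.
- by rewrite !posdim_basis bdry_basis /= !raddf0.
- by rewrite !posdim_basis bdry_basis /= !raddf0 ?addr0 posdim_basis /= raddf0.
- rewrite !posdim_basis bdry_basis /= raddf0 subr0 cone_basis posdimB.
  rewrite !posdim_basis /= !normalizeB !normalize_basis /translate !push_basis /=.
  by rewrite !mulVg !subrr.
rewrite !posdim_basis bdry_basis /= coneB !posdimB posdim_cone2.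
by rewrite -!cone_basis !posdim_cone2.
Qed.

(** Simplices of dimension at most [n] are lists of at most [n + 1] vertices.
    Projecting to positive dimension replaces the homotopy from the trivial
    homomorphism by an honest null-homotopy. *)
Definition null_upto (G A : groupType) (i : G -> A)
    (P : chains G -> chains A) (n : nat) : Prop :=
  forall s, (size s <= n.+1)%N ->
  normalize (bdry (P (basis s)) + P (bdry (basis s))) =
  normalize (push i (posdim (basis s))).

(** * The inductive step *)

Section Mitosis.
Variables (G A M : groupType) (i : G -> A) (a b : A -> M) (w : M).
Hypothesis iM : {morph i : x y / (x * y)%g}.
Hypothesis aM : {morph a : x y / (x * y)%g}.
Hypothesis bM : {morph b : x y / (x * y)%g}.
Hypothesis abC : forall x y, (a x * b y = b y * a x)%g.
Hypothesis ab_conj : forall x, (a x * b x = w * b x * w^-1)%g.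

Let m x y := (a x * b y)%g.
Let shB := shuffle_biadditive m.

(** Translation of the left factor by [g] translates the product by [a g];
    on the right the factor [b g] has first to move past the values of [a]. *)
Lemma shuffle_descendsl z : descends (fun x => shuffle m x z).
Proof.
apply: descendsP => [x y|g s]; first by rewrite (biaddBl shB).
have mm v u : m (g * v)%g (id u) = (a g * m v u)%g by rewrite /m aM mulgA.
by rewrite -{1}[z]push_id (shuffle_push mm) normalize_translate.
Qed.

Lemma shuffle_descendsr x : descends (shuffle m x).
Proof.
apply: descendsP => [z y|g s]; first by rewrite (biaddBr shB).
have mm v u : m (id v) (g * u)%g = (b g * m v u)%g.
  by rewrite /m bM !mulgA (abC v g).
by rewrite -{1}[x]push_id (shuffle_push mm) normalize_translate.
Qed.

Variables (n : nat) (P : {additive chains G -> chains A}).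
Hypothesis P_small : forall s, (size s <= 1)%N -> P (basis s) = 0.
Hypothesis P_alt : forall x, alt (P x) = - P (alt x).
Hypothesis P_desc : descends P.
Hypothesis P_null : null_upto i P n.

Let X y z := shuffle m (P y) (push i (posdim z)).

Let X_biadditive : biadditive X.
Proof.
split=> z x y; rewrite /X; first by rewrite raddfB (biaddBl shB).
by rewrite posdimB pushB (biaddBr shB).
Qed.

(** The three terms are the conjugation [b ~ ab], the Eilenberg-Zilber homotopy
    from [ab] to the sum over cuts, and the null-homotopy of the inner cuts. *)
Definition mitosis0 (x : chains G) : chains M :=
  prism b (fun v => b v * w^-1)%g (push i x) - diag_fill m (push i x) - cuts X x.

(** On vertices [mitosis0] gives edges that are loops in the bar complex; they
    are discarded so that the homotopy vanishes in dimension zero. *)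
Definition mitosis : chains G -> chains M :=
  freeg_lift (fun s => mitosis0 (posdim (basis s))).
HB.instance Definition _ := GRing.Additive.on mitosis.

Lemma mitosis0B : {morph mitosis0 : x y / x - y}.
Proof.
move=> x y; rewrite /mitosis0 pushB cutsB diag_fillB (raddfB (prism _ _)) /=.
by freeg_abel.
Qed.

Lemma mitosisE x : mitosis x = mitosis0 (posdim x).
Proof.
elim/freeg_ind: x => [|x y IHx IHy|s].
- by rewrite !raddf0 /mitosis0 !raddf0 !addr0.
- by rewrite posdimB mitosis0B -IHx -IHy raddfB.
by rewrite /mitosis freeg_lift_basis.
Qed.

Lemma mitosis0_descends : descends mitosis0.
Proof.
apply: descendsP => [|g s]; first exact: mitosis0B.
rewrite /mitosis0 translate_push// !normalizeB; congr (_ - _ - _).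
- rewrite (@prism_push _ _ _ _ b (fun v => b v * w^-1)%g _ _ _
      (fun v => b (i g) * v)%g); first exact: normalize_translate.
    by move=> v; rewrite bM.
  by move=> v; rewrite bM mulgA.
- have mm v u : m (i g * v)%g (i g * u)%g = (m (i g) (i g) * m v u)%g.
    by rewrite /m aM bM -!mulgA; congr (_ * _)%g; rewrite !mulgA abC.
  by rewrite (diag_fill_push mm); apply: normalize_translate.
rewrite /translate push_basis !cuts_basis /cuts0 size_map !raddf_sum.
apply: eq_bigr => p _; rewrite -map_take -map_drop -!push_basis /X /=.
transitivity (normalize (shuffle m (P (basis (take p.+1 s)))
    (push i (posdim (push (fun v => g * v)%g (basis (drop p s))))))).
  by apply: shuffle_descendsl; apply: P_desc; apply: normalize_translate.
apply: shuffle_descendsr; apply: (push_descends iM); apply: posdim_descends.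
exact: normalize_translate.
Qed.

(** The Leibniz rule for [X] produces [shuffle m (bdry (P y)) _], in which
    [bdry (P y)] is [i] minus [P] of the boundary. The second part reassembles,
    with the boundary of the back face, into the boundary of the whole cut sum.
    A simplex with at most [n + 2] vertices suffices because a back face of
    positive dimension leaves at most [n + 1] of them to the front. *)
Lemma cuts_null s : (size s <= n.+2)%N ->
  normalize (bdry (cuts X (basis s)) + cuts X (bdry (basis s))) =
  normalize (cuts (fun y z =>
    shuffle m (push i (posdim y)) (push i (posdim z))) (basis s)).
Proof.
move=> les.
pose dX y z := X (bdry y) z - X (alt y) (bdry z).
suff bdry_X : normalize (bdry (cuts X (basis s))) = normalize (cuts (fun y z =>
    shuffle m (push i (posdim y)) (push i (posdim z))) (basis s)
    - cuts dX (basis s)).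
  rewrite normalizeD bdry_X -normalizeD (cuts_bdry _ X_biadditive).
  have -> : X (basis [::]) (basis s) = 0.
    by rewrite /X P_small// (biadd0l shB).
  have -> : X (alt (basis s)) (basis [::]) = 0.
    by rewrite /X posdim_basis /= raddf0 (biadd0r shB).
  by rewrite addr0 subr0 subrK.
rewrite !cuts_basis /cuts0 -sumrB !raddf_sum; apply: eq_bigr => p _ /=.
set y := basis (take _ _); set z := basis (drop _ _).
rewrite {1}/X shuffle_bdry P_alt (biaddNl shB) opprK.
have -> : shuffle m (push i (posdim y)) (push i (posdim z)) - dX y z =
    (shuffle m (push i (posdim y)) (push i (posdim z)) - X (bdry y) z)
    + X (alt y) (bdry z) by rewrite /dX; freeg_abel.
rewrite [in LHS]normalizeD [in RHS]normalizeD; congr (_ + _); last first.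
  apply: shuffle_descendsr; rewrite -push_bdry; apply: push_descends => //.
  by rewrite posdim_bdry.
rewrite /X -(biaddBl shB).
have [lt1z|le_z1] := ltnP 1 (size (drop p s)); last first.
  by rewrite /z posdim_basis ltnNge le_z1 raddf0 !(biadd0r shB).
apply: shuffle_descendsl; rewrite normalizeB -P_null; last first.
  have take_le k l : (l <= n.+2)%N -> (1 < l - k)%N ->
    ((if (k.+1 < l)%N then k.+1 else l) <= n.+1)%N by case: ifP; lia.
  by rewrite size_take; apply: take_le les _; rewrite -size_drop.
by rewrite normalizeD addrK.
Qed.

(** The first cut has a point as front, so its shuffle product is [b] translated
    by the value of [a] at that point; symmetrically the last cut is [a]
    translated, which uses that the two images commute. *)
Lemma aw_shuffle_split s : (1 < size s)%N ->
  normalize (aw_shuffle m (basis s)) =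
  normalize (push a (basis s) + push b (basis s)
    + cuts (fun y z => shuffle m (posdim y) (posdim z)) (basis s)).
Proof.
case: s => [//|v s]; case/lastP: s => [//|s u] _.
have -> : aw_shuffle m (basis (v :: rcons s u)) =
    cuts (shuffle m) (basis (v :: rcons s u)).
  by rewrite /aw_shuffle -cone_basis augm_cone addr0.
rewrite !cuts_basis /cuts0 /= size_rcons.
rewrite big_ord_recl big_ord_recr [in RHS]big_ord_recl [in RHS]big_ord_recr /=.
rewrite /bump !add0n !add1n !take0 -(size_rcons s u) take_size.
rewrite -cats1 drop_size_cat //= !cats1.
rewrite !posdim_basis /= size_rcons (biadd0l shB) (biadd0r shB) add0r addr0.
rewrite shuffle1l shuffle1r !normalizeD.
have -> : normalize (basis (map (m v) (v :: rcons s u))) =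
    normalize (push b (basis (v :: rcons s u))).
  rewrite -(normalize_translate (a v) (push b _)) /translate push_comp.
  by rewrite push_basis.
have -> : normalize (basis (map (m^~ u) (v :: rcons s u))) =
    normalize (push a (basis (v :: rcons s u))).
  rewrite -(normalize_translate (b u) (push a _)) /translate push_comp.
  rewrite push_basis; congr (normalize (basis _)).
  by apply: eq_map => x; apply: abC.
rewrite addrA addrC addrA; congr (_ + normalize _); apply: eq_bigr => p _.
have ltp := ltn_ord p; rewrite !posdim_basis !ifT//.
  by rewrite size_drop size_rcons add0n ltn_subRL addn1 ltnS.
by rewrite /= size_take size_rcons; case: ifP.
Qed.

Lemma mitosis_null : null_upto (a \o i) mitosis n.+1.
Proof.
move=> s les; rewrite !mitosisE normalizeD.
rewrite [normalize (mitosis0 _)](mitosis0_descends (posdim_bdry _)) -normalizeD.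
rewrite posdim_basis; case: ifPn => [lt1s|_]; last first.
  have m0 : mitosis0 0 = 0 by rewrite -(subrr 0) mitosis0B subrr.
  by rewrite (raddf0 (@bdry G)) m0 !raddf0 ?addr0 ?raddf0.
have -> : bdry (mitosis0 (basis s)) + mitosis0 (bdry (basis s)) =
    (bdry (prism b (fun v => b v * w^-1)%g (push i (basis s)))
     + prism b (fun v => b v * w^-1)%g (bdry (push i (basis s))))
    - (bdry (diag_fill m (push i (basis s)))
       + diag_fill m (bdry (push i (basis s))))
    - (bdry (cuts X (basis s)) + cuts X (bdry (basis s))).
  by rewrite /mitosis0 !bdryB -!push_bdry; freeg_abel.
rewrite prism_homotopy diag_fill_homotopy 2!normalizeB cuts_null//.
rewrite (normalizeB (push (fun v => m v v) _)) push_basis aw_shuffle_split ?size_map//.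
have -> : normalize (push (fun v => m v v) (basis (map i s))) =
    normalize (push (fun v => b v * w^-1)%g (basis (map i s))).
  rewrite -(normalize_translate w (push (fun v => b v * w^-1)%g _)).
  rewrite /translate push_comp; congr normalize; apply: eq_push => v /=.
  by rewrite /m ab_conj mulgA.
rewrite -[basis (map i s)]push_basis.
rewrite (@cuts_push _ _ _ _ (fun y z =>
  shuffle m (push i (posdim y)) (push i (posdim z))) _ i idfun) /=; last first.
  by move=> y z; rewrite -!push_basis -!push_posdim.
rewrite -(push_comp a i) normalizeB !normalizeD; freeg_abel.
Qed.
End Mitosis.

(** * Counting simplices *)

Section Bounded.
Variables (K : choiceType) (D : pred K).

(** An upper bound on the diameter that also records that all terms satisfy [D];
    [D] is needed because the size of the image of a simplex depends on its
    dimension. *)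
Inductive bounded : nat -> {freeg K} -> Prop :=
| bounded0 n : bounded n 0
| boundedD n c x : D c -> bounded n x -> bounded n.+1 (basis c + x)
| boundedB n c x : D c -> bounded n x -> bounded n.+1 (- basis c + x).

Lemma bounded_le n n' x : (n <= n')%N -> bounded n x -> bounded n' x.
Proof.
move=> len bx; elim: bx n' len => {n x} [n|n c x Dc _ IH|n c x Dc _ IH] n'.
- by move=> _; constructor.
- by case: n' => // n' len; apply: boundedD => //; apply: IH.
by case: n' => // n' len; apply: boundedB => //; apply: IH.
Qed.

Lemma bounded_add n n' x y :
  bounded n x -> bounded n' y -> bounded (n + n') (x + y).
Proof.
move=> bx byy; elim: bx => {n x} [n|n c x Dc _ IH|n c x Dc _ IH].
- by rewrite add0r; apply: bounded_le byy; rewrite leq_addl.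
- by rewrite -addrA; apply: boundedD.
by rewrite -addrA; apply: boundedB.
Qed.

Lemma bounded_opp n x : bounded n x -> bounded n (- x).
Proof.
elim=> {n x} [n|n c x Dc _ IH|n c x Dc _ IH]; first by rewrite oppr0; constructor.
  by rewrite opprD; apply: boundedB.
by rewrite opprD opprK; apply: boundedD.
Qed.

Lemma bounded_sign n x k : bounded n x -> bounded n (x *~ (-1) ^+ k).
Proof.
rewrite -signr_odd; case: (odd k); rewrite ?expr1 ?mulrN1z ?mulr1z//.
exact: bounded_opp.
Qed.

Lemma bounded_basis c : D c -> bounded 1 (basis c).
Proof.
by move=> Dc; rewrite -[basis c]addr0; apply: boundedD => //; constructor.
Qed.

Lemma bounded_sum m (F : 'I_m -> {freeg K}) (N : 'I_m -> nat) :
  (forall p, bounded (N p) (F p)) -> bounded (\sum_(p < m) N p) (\sum_(p < m) F p).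
Proof.
move=> bF; apply: (big_ind2 bounded) => //; first by constructor.
by move=> n x n' y; apply: bounded_add.
Qed.

Lemma diameterN_basis (b : bool) (c : K) (x : {freeg K}) :
  (diameter (basis c *~ (-1) ^+ b + x)%R <= (diameter x).+1)%N.
Proof.
have diam_cover (y : {freeg K}) (s : seq K) : uniq s -> {subset dom y <= s} ->
    diameter y = (\sum_(d <- s) `|coeff d y|)%N.
  move=> us sub; rewrite /diameter [RHS](bigID (mem (dom y))) /=.
  rewrite [X in (_ + X)%N]big1 ?addn0; last first.
    by move=> d dy; rewrite coeff_outdom.
  rewrite -[RHS]big_filter; apply: perm_big; apply: uniq_perm; rewrite ?uniq_dom//.
    by rewrite filter_uniq.
  by move=> d; rewrite mem_filter; case dy: (d \in dom y) => //=; rewrite sub.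
pose y := (basis c *~ (-1) ^+ b + x)%R.
pose s := undup (c :: dom y ++ dom x).
have us : uniq s by rewrite undup_uniq.
rewrite (diam_cover y s us); last first.
  by move=> d dy; rewrite mem_undup in_cons mem_cat dy orbT.
rewrite (diam_cover x s us); last first.
  by move=> d dy; rewrite mem_undup in_cons mem_cat dy !orbT.
have cs : c \in s by rewrite mem_undup mem_head.
rewrite !(bigD1_seq c cs us) /= -addSn; apply: leq_add.
  rewrite /y coeffD raddfMz /= coeff_basis eqxx.
  by case: b {y s us cs}; rewrite ?expr1 ?mulrN1z ?mulr1z; lia.
apply: eq_leq; apply: eq_bigr => d dc.
by rewrite /y coeffD raddfMz /= coeff_basis eq_sym (negPf dc) mul0rz add0r.
Qed.

Lemma diameter_bounded n x : bounded n x -> (diameter x <= n)%N.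
Proof.
elim=> {n x} [n|n c x Dc _ IH|n c x Dc _ IH].
- by rewrite /diameter dom0 big_nil.
- apply: leq_trans (_ : (diameter x).+1 <= _)%N => //.
  by have := diameterN_basis false c x; rewrite expr0 mulr1z.
apply: leq_trans (_ : (diameter x).+1 <= _)%N => //.
by have := diameterN_basis true c x; rewrite expr1 mulrN1z.
Qed.
End Bounded.

Lemma bounded_image (K L : choiceType) (D : pred K) (E : pred L) (k : nat)
    (f : {additive {freeg K} -> {freeg L}}) :
  (forall c, D c -> bounded E k (f (basis c))) ->
  forall n x, bounded D n x -> bounded E (n * k) (f x).
Proof.
move=> bf n x; elim=> {n x} [n|n c x Dc _ IH|n c x Dc _ IH].
- by rewrite raddf0; constructor.
- by rewrite raddfD mulSn; apply: bounded_add => //; apply: bf.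
by rewrite raddfD raddfN mulSn; apply: bounded_add => //; apply/bounded_opp/bf.
Qed.

Local Notation bounded_dim k := (bounded (fun s => size s == k)).

Lemma bounded_cone (V : choiceType) (v : V) k n x :
  bounded_dim k n x -> bounded_dim k.+1 n (cone v x).
Proof.
rewrite -{2}[n]muln1; apply: bounded_image => s sk /=.
by rewrite cone_basis; apply: bounded_basis.
Qed.

Lemma alt_bounded (V : choiceType) k n (x : chains V) :
  bounded_dim k n x -> alt x = x *~ (-1) ^+ k.
Proof.
elim=> {n x} [n|n c x /eqP sc _ IH|n c x /eqP sc _ IH].
- by rewrite raddf0 mul0rz.
- by rewrite raddfD /= IH alt_basis sc mulrzDl.
by rewrite raddfD /= IH altN alt_basis sc mulrzDl mulNrz.
Qed.

(** Lattice paths in a grid are counted by binomial coefficients, and the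
    recursion of [shuffle0] is Pascal's rule. *)
Lemma bounded_shuffle (V W U : choiceType) (m : V -> W -> U) v s w t :
  bounded_dim (size s + size t).+1 'C(size s + size t, size s)
    (shuffle m (basis (v :: s)) (basis (w :: t))).
Proof.
elim: s v w t => [|v' s IHs] v w t.
  by rewrite shuffle1l bin0; apply: bounded_basis; rewrite /= size_map.
elim: t w => [|w' t IHt] w.
  rewrite shuffle1r addn0 binn; apply: bounded_basis.
  by rewrite /= size_map.
rewrite shuffle_basis /= addnS binS; apply: bounded_cone; rewrite addnC.
rewrite addrC addnC; apply: bounded_add.
  apply: bounded_sign; have := IHt w'; rewrite shuffle_basis /=.
  by rewrite -addnS addSnnS.
by have := IHs v' w (w' :: t); rewrite shuffle_basis /= addnS addSn.
Qed.

Lemma bounded_cuts (V M : choiceType) (D : pred M)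
    (B : chains V -> chains V -> {freeg M}) (N : nat -> nat) s :
  (forall p, (p < size s)%N ->
     bounded D (N p) (B (basis (take p.+1 s)) (basis (drop p s)))) ->
  bounded D (\sum_(p < size s) N p) (cuts B (basis s)).
Proof.
by move=> bB; rewrite cuts_basis; apply: bounded_sum => p; apply: bB.
Qed.

Lemma bounded_prism (V W : choiceType) (f g : V -> W) s :
  bounded_dim (size s).+1 (size s) (prism f g (basis s)).
Proof.
rewrite prism_basis; elim: s => [|v s IH] /=; first by constructor.
apply: bounded_cone; rewrite -add1n; apply: bounded_add.
  by rewrite push_basis; apply: bounded_basis; rewrite /= size_map.
exact: bounded_opp.
Qed.

Lemma sum_bin n : (\sum_(p < n) 'C(n, p.+1) = (2 ^ n).-1)%N.
Proof.
have := expnDn 1 1 n; rewrite big_ord_recl bin0 => ->.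
by rewrite !exp1n !muln1 add1n /=; apply: eq_bigr => p _; rewrite !exp1n !muln1.
Qed.

Lemma bounded_diag_fill (V U : choiceType) (m : V -> V -> U) s :
  bounded_dim (size s).+1 (2 ^ size s - (size s).+1)%N (diag_fill m (basis s)).
Proof.
rewrite diag_fill_basis; elim: s => [|v s IH]; first by constructor.
have -> : (2 ^ size (v :: s) - (size (v :: s)).+1 =
    \sum_(p < size s) 'C(size s, p.+1) + (2 ^ size s - (size s).+1))%N.
  rewrite sum_bin /= expnS; have := ltn_expl (size s) (ltnSn 1); lia.
apply/bounded_opp/bounded_cone/bounded_add => //.
apply: (@bounded_cuts _ _ _ _ (fun p => 'C(size s, p.+1))) => p ltp.
rewrite cone_basis; have sdrop := size_drop p s.
case: (drop p s) sdrop => [|w t] /= st; first by lia.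
have := bounded_shuffle m v (take p.+1 s) w t.
rewrite size_take_min; have -> : (minn p.+1 (size s) + size t = size s)%N by lia.
by have -> : minn p.+1 (size s) = p.+1 by lia.
Qed.

(** * The diameter recursion *)

(** The prism and the Eilenberg-Zilber homotopy contribute [2 ^ k - 1] terms
    together, and each inner cut a number of shuffles for every term of the
    null-homotopy of its front. As the sum involves only [j < k], iteration
    from any function stabilizes, and its limit [control] is a fixed point. *)
Definition controlled_step (f : nat -> nat) (k : nat) : nat :=
  (if k <= 1 then 0 else (2 ^ k).-1 + \sum_(j < k) f j * 'C(k, j))%N.

Definition control (k : nat) : nat := iter k.+1 controlled_step (fun=> 0%N) k.

Lemma controlled_step_local f g k :
  (forall j, (j < k)%N -> f j = g j) -> controlled_step f k = controlled_step g k.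
Proof.
move=> fg; rewrite /controlled_step; case: ifP => // _; congr (_ + _)%N.
by apply: eq_bigr => j _; rewrite fg.
Qed.

Lemma iter_controlled_step n k : (k < n)%N ->
  iter n controlled_step (fun=> 0%N) k = control k.
Proof.
elim/ltn_ind: n k => -[//|n] IH k; rewrite ltnS => le_kn.
rewrite /control /=; apply: controlled_step_local => j lt_jk.
by rewrite (IH n)// ?(leq_trans lt_jk)// (IH k).
Qed.

Lemma controlE k : control k = controlled_step control k.
Proof.
rewrite /control /=; apply: controlled_step_local => j ltj.
exact: iter_controlled_step.
Qed.

(** The induction hypothesis. Its last field alone would not survive the
    inductive step: [P] is applied to faces of translated simplices and its
    values enter products, which needs descent to the quotient and control of
    the dimension. *)
Record contraction (G A : groupType) (i : G -> A) (n : nat)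
    (P : {additive chains G -> chains A}) : Prop := Contraction {
  contraction_small : forall s, (size s <= 1)%N -> P (basis s) = 0;
  contraction_descends : descends P;
  contraction_bounded : forall s,
    bounded_dim (size s).+1 (control (size s)) (P (basis s));
  contraction_null : null_upto i P n
}.

(** [P] raises dimension by one, so it anticommutes with the sign. *)
Lemma contraction_alt (G A : groupType) (i : G -> A) n
    (P : {additive chains G -> chains A}) :
  contraction i n P -> forall x, alt (P x) = - P (alt x).
Proof.
move=> cP x; elim/freeg_ind: x => [|x y IHx IHy|s]; first by rewrite !raddf0.
  by rewrite (raddfB P) !altB IHx IHy (raddfB P) -opprD.
rewrite (alt_bounded (contraction_bounded cP s)) alt_basis raddfMz /=.
by rewrite exprS mulN1r mulrNz.
Qed.

Lemma contraction0 (G A : groupType) (i : G -> A) : contraction i 0 \0.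
Proof.
split=> // [s|s le_s]; first by constructor.
by rewrite posdim_basis ltnNge le_s /= !raddf0 addr0 raddf0.
Qed.

Section MitosisContraction.
Variables (G A M : groupType) (i : G -> A) (a b : A -> M) (w : M).
Hypothesis iM : {morph i : x y / (x * y)%g}.
Hypothesis aM : {morph a : x y / (x * y)%g}.
Hypothesis bM : {morph b : x y / (x * y)%g}.
Hypothesis abC : forall x y, (a x * b y = b y * a x)%g.
Hypothesis ab_conj : forall x, (a x * b x = w * b x * w^-1)%g.
Variables (n : nat) (P : {additive chains G -> chains A}).
Hypothesis cP : contraction i n P.

Lemma bounded_mitosis s :
  bounded_dim (size s).+1 (control (size s)) (mitosis i a b w P (basis s)).
Proof.
rewrite controlE /controlled_step mitosisE posdim_basis.
case: (ltnP 1 (size s)) => [lt1s|_]; last first.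
  have -> : mitosis0 i a b w P 0 = 0 by rewrite /mitosis0 !raddf0 !addr0.
  by constructor.
rewrite /= /mitosis0 push_basis.
have -> : ((2 ^ size s).-1 = size s + (2 ^ size s - (size s).+1))%N.
  by have := ltn_expl (size s) (ltnSn 1); lia.
have /esym szm := size_map i s.
apply: bounded_add; last first.
  apply: bounded_opp.
  pose N p := (if p.+1 < size s then control p.+1 * 'C(size s, p.+1) else 0)%N.
  apply: (@bounded_le _ _ (\sum_(p < size s) N p)%N).
    case: (size s) lt1s @N => // k _ N; rewrite big_ord_recr big_ord_recl /= /N.
    rewrite ltnn addn0 -[X in (X <= _)%N]add0n; apply: leq_add => //.
    by apply: leq_sum => p _; case: ifP.
  apply: bounded_cuts => p ltp; rewrite /N posdim_basis size_drop ltn_subRL addn1.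
  case: ifP => lts; last first.
    by rewrite raddf0 (biadd0r (shuffle_biadditive _)); constructor.
  rewrite push_basis; have := contraction_bounded cP (take p.+1 s).
  rewrite size_take lts; apply: (bounded_image
    (f := freeg_lift (fun u => freeg_lift (shuffle0 _ u) _))) => u /eqP su /=.
  rewrite -/(shuffle _ _ _).
  have: size (map i (drop p s)) = (size s - p)%N by rewrite size_map size_drop.
  case: u su => [//|x u] [su]; case: (map i (drop p s)) => [|y t] /= st.
    by move/eqP: st; rewrite eq_sym subn_eq0 leqNgt ltp.
  have := bounded_shuffle (fun x y => a x * b y)%g x u y t; rewrite su.
  by have -> : (p.+1 + size t = size s)%N by rewrite addSnnS st subnKC// ltnW.
apply: bounded_add; rewrite {1 2}szm; first exact: bounded_prism.
by rewrite szm; apply/bounded_opp/bounded_diag_fill.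
Qed.

Lemma mitosis_contraction :
  contraction (a \o i) n.+1 (mitosis i a b w P).
Proof.
split=> [s le_s|x y xy|s|].
- rewrite /= mitosisE posdim_basis ltnNge le_s /=.
  by rewrite /mitosis0 !raddf0 !addr0.
- rewrite /= !mitosisE; apply: mitosis0_descends => //.
    exact: contraction_descends cP.
  exact: posdim_descends.
- exact: bounded_mitosis.
apply: mitosis_null => //.
- exact: contraction_small cP.
- exact: contraction_alt cP.
- exact: contraction_descends cP.
exact: contraction_null cP.
Qed.
End MitosisContraction.

(** * The groups of the tower *)

Section MGroup.
Variable A : groupType.
Let M := mgroup A.

Definition mU : M := pcls (@mrel A) wu.
Definition mT : M := pcls (@mrel A) wt.
Definition kmapU (x : A) : M := (mU * kmap x * mU^-1)%g.

Lemma kmapUM : {morph kmapU : x y / (x * y)%g}.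
Proof. by move=> x y; rewrite /kmapU kmapM !mulgA mulgVK. Qed.

Lemma kmap_kmapUC x y : (kmap x * kmapU y = kmapU y * kmap x)%g.
Proof.
have /pclsP := derivable_rel (mrel_comm y x).
rewrite /wcomm /wconj !(pclsM, pclsV) pcls1 => /divg1_eq xyx.
by rewrite -[LHS](mulgVK (kmap x)) xyx.
Qed.

Lemma kmap_kmapU_conj x :
  (kmap x * kmapU x = (mT * mU^-1) * kmapU x * (mT * mU^-1)^-1)%g.
Proof.
have /pclsP := derivable_rel (mrel_conj x).
rewrite /wconj !(pclsM, pclsV) => <-.
by rewrite /kmapU invgM invgK !mulgA !mulgVK.
Qed.
End MGroup.

(** The step is applied with [w = t u^-1]. *)
Lemma imap_contraction (n : nat) (G : groupType) :
  {P : {additive chains G -> chains (Agroup n G)} | contraction (imap n G) n P}.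
Proof.
elim: n => [|n [P cP]]; first by exists \0; apply: contraction0.
exists (mitosis (imap n G) (@kmap _) (@kmapU _) (mT _ * (mU _)^-1)%g P).
apply: (mitosis_contraction _ _ _ _ _ cP).
- exact: gmulfM.
- exact: kmapM.
- exact: kmapUM.
- exact: kmap_kmapUC.
exact: kmap_kmapU_conj.
Qed.

(** * Comparison with the bar complex *)

Section BarChains.
Variable G : groupType.

(** The edge labels of a simplex; lists of the wrong length go to zero. *)
Definition to_bar k : chains G -> {freeg (k.-tuple G)} :=
  freeg_lift (fun s => if size s == k.+1 then
    basis [tuple (nth 1 s j)^-1 * nth 1 s j.+1 | j < k]%g else 0).
HB.instance Definition _ k := GRing.Additive.on (to_bar k).

(** The lift of a bar cell to the homogeneous simplex that starts at the
    identity. *)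
Definition of_bar k : {freeg (k.-tuple G)} -> chains G :=
  freeg_lift (fun c : k.-tuple G =>
    basis (1%g :: scanl (fun x y : G => x * y)%g 1%g c)).
HB.instance Definition _ k := GRing.Additive.on (@of_bar k).

Lemma to_bar_basis k s : size s = k.+1 ->
  to_bar k (basis s) =
  basis [tuple (nth 1 s j)^-1 * nth 1 s j.+1 | j < k]%g.
Proof. by move=> sk; rewrite /to_bar freeg_lift_basis sk eqxx. Qed.

Lemma to_bar_small k s : size s <> k.+1 -> to_bar k (basis s) = 0.
Proof. by move=> /eqP /negPf sk; rewrite /to_bar freeg_lift_basis sk. Qed.

Lemma to_barB k : {morph to_bar k : x y / x - y}.
Proof. exact: raddfB. Qed.

Lemma to_bar_normalize k x : to_bar k (normalize x) = to_bar k x.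
Proof.
elim/freeg_ind: x => [|x y IHx IHy|s]; first by rewrite !raddf0.
  by rewrite normalizeB !to_barB IHx IHy.
rewrite normalize_basis /translate push_basis.
have [sk|sk] := eqVneq (size s) k.+1; last first.
  by rewrite !to_bar_small ?size_map//; apply/eqP.
rewrite !to_bar_basis ?size_map//; congr basis; apply: eq_from_tnth => j.
rewrite !tnth_mktuple !(nth_map 1%g) ?sk ?ltnS// 1?ltnW//.
by rewrite invgM -mulgA mulKg.
Qed.

Lemma bdry0_sum (s : seq G) : bdry0 s =
  \sum_(0 <= i < size s) basis (take i s ++ drop i.+1 s) *~ (-1) ^+ i.
Proof.
rewrite big_mkord.
elim: s => [|v s IH] /=; first by rewrite big_ord0.
rewrite big_ord_recl /= drop0 expr0 mulr1z IH raddf_sum -sumrN.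
congr (_ + _); apply: eq_bigr => j _ /=.
by rewrite raddfMz /= cone_basis exprS mulN1r mulrNz.
Qed.

Lemma nth_delete (s : seq G) i j : (i < size s)%N ->
  nth 1%g (take i s ++ drop i.+1 s) j =
  if (j < i)%N then nth 1%g s j else nth 1%g s j.+1.
Proof.
move=> lti; rewrite nth_cat size_takel ?(ltnW lti)//; case: ifP => ltj.
  by rewrite nth_take.
by rewrite nth_drop; congr (nth _ s _); lia.
Qed.

Lemma size_delete (s : seq G) i : (i < size s)%N ->
  size (take i s ++ drop i.+1 s) = (size s).-1.
Proof.
by move=> lti; rewrite size_cat size_takel ?(ltnW lti)// size_drop; lia.
Qed.

Lemma bar_bdB k : {morph @bar_bd G k : x y / x - y}.
Proof. exact: raddfB. Qed.

Lemma to_bar_bdry k x : bar_bd (to_bar k.+1 x) = to_bar k (bdry x).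
Proof.
elim/freeg_ind: x => [|x y IHx IHy|s]; first by rewrite !raddf0.
  by rewrite to_barB bar_bdB IHx IHy bdryB to_barB.
rewrite bdry_basis bdry0_sum raddf_sum.
have [sk|/eqP sk] := eqVneq (size s) k.+2; last first.
  rewrite to_bar_small// raddf0 big_nat big1// => i /= lti; rewrite raddfMz /=.
  rewrite to_bar_small ?mul0rz// size_delete//.
  by case: (size s) sk lti => // l sk _ /= lk; apply: sk; rewrite lk.
rewrite to_bar_basis// bar_bd_basis sk.
rewrite -(big_mkord xpredT (fun i => basis (face i _) *~ (-1) ^+ i)) /=.
apply: eq_big_nat => i /= ltik; rewrite raddfMz /=.
have lti : (i < size s)%N by rewrite sk.
rewrite to_bar_basis ?size_delete ?sk//; congr (basis _ *~ _).
apply: eq_from_tnth => j; rewrite !tnth_mktuple !nth_delete//.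
have nthE l : (l < k.+1)%N ->
    nth 1%g [tuple (nth 1 s j)^-1 * nth 1 s j.+1 | j < k.+1]%g l =
    ((nth 1 s l)^-1 * nth 1 s l.+1)%g.
  by move=> ltl; rewrite -(tnth_nth _ _ (Ordinal ltl)) tnth_mktuple.
have ltj := ltn_ord j; rewrite (nthE j (ltnW ltj)) (nthE j.+1 ltj).
by case: (ltngtP j.+1 i) => // _; rewrite -mulgA mulVKg.
Qed.

Lemma size_path k (c : k.-tuple G) :
  size (1%g :: scanl (fun x y => x * y)%g 1%g c) = k.+1.
Proof. by rewrite /= size_scanl size_tuple. Qed.

Lemma of_bar_basis k (c : k.-tuple G) :
  of_bar (basis c) = basis (1%g :: scanl (fun x y => x * y)%g 1%g c).
Proof. exact: freeg_lift_basis. Qed.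

Lemma of_barB k : {morph @of_bar k : x y / x - y}.
Proof. exact: raddfB. Qed.

Lemma step_path (x : G) s j : (j < size s)%N ->
  ((nth 1 (x :: scanl (fun x y => x * y) x s) j)^-1 *
    nth 1 (x :: scanl (fun x y => x * y) x s) j.+1 = nth 1 s j)%g.
Proof.
by elim: s x j => //= y s IH x [|j] lj; [rewrite mulKg | exact: (IH (x * y)%g)].
Qed.

Lemma of_barK k x : to_bar k (of_bar x) = x.
Proof.
elim/freeg_ind: x => [|x y IHx IHy|c]; first by rewrite !raddf0.
  by rewrite of_barB to_barB IHx IHy.
rewrite of_bar_basis to_bar_basis ?size_path//; congr basis.
apply: eq_from_tnth => j; rewrite tnth_mktuple step_path ?size_tuple//.
by rewrite -tnth_nth.
Qed.

Lemma scanl_pairmap (y x : G) s :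
  scanl (fun x y => x * y)%g y (pairmap (fun a b => a^-1 * b)%g x s) =
  map (fun z => y * x^-1 * z)%g s.
Proof.
elim: s x y => //= z s IH x y; rewrite IH mulgA; congr cons.
by apply: eq_map => t /=; rewrite mulgK.
Qed.

Lemma of_bar_to_bar k s : size s = k.+1 ->
  normalize (of_bar (to_bar k (basis s))) = normalize (basis s).
Proof.
move=> sk; rewrite to_bar_basis// of_bar_basis.
case: s sk => [//|x s] [sk].
have -> : [tuple (nth 1 (x :: s) j)^-1 * nth 1 (x :: s) j.+1 | j < k]%g =
    pairmap (fun a b => a^-1 * b)%g x s :> seq G.
  apply: (@eq_from_nth _ 1%g) => [|j].
    by rewrite size_tuple size_pairmap.
  rewrite size_tuple => ltj.
  by rewrite (nth_pairmap 1%g) ?sk// -(tnth_nth _ _ (Ordinal ltj)) tnth_mktuple.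
rewrite scanl_pairmap -(normalize_translate x^-1%g (basis (x :: s))).
by rewrite /translate push_basis /= mulVg mul1g.
Qed.

(** Only up to translation: the zeroth face of the lift starts at the first
    entry of the cell instead of the identity. *)
Lemma of_bar_bdry k x :
  normalize (of_bar (@bar_bd G k x)) = normalize (bdry (of_bar x)).
Proof.
elim/freeg_ind: x => [|x y IHx IHy|c]; first by rewrite !raddf0.
  by rewrite bar_bdB !of_barB bdryB !normalizeB IHx IHy.
rewrite -{1}[basis c]of_barK to_bar_bdry of_bar_basis.
move: (1%g :: _) (size_path c) => s sk.
rewrite bdry_basis bdry0_sum !raddf_sum; apply: eq_big_nat => i /= lti.
by rewrite !raddfMz /= of_bar_to_bar// size_delete// sk.
Qed.
End BarChains.

Lemma bar_mapB (G H : groupType) (f : {multiplicative G -> H}) k :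
  {morph @bar_map G H f k : x y / x - y}.
Proof. exact: raddfB. Qed.

Lemma to_bar_map (G H : groupType) (f : {multiplicative G -> H}) k
    (c : k.-tuple G) :
  to_bar k (push f (of_bar (basis c))) = bar_map f (basis c).
Proof.
rewrite bar_map_basis of_bar_basis push_basis.
rewrite to_bar_basis ?size_map ?size_path//.
congr basis; apply: eq_from_tnth => j.
rewrite tnth_mktuple tnth_map (tnth_nth 1%g c).
have ltj := ltn_ord j; have ltjc : (j < size c)%N by rewrite size_tuple.
have := step_path 1%g ltjc; have := size_path c; move: (_ :: _) => s sk <-.
have fVM x y : f (x^-1 * y)%g = ((f x)^-1 * f y)%g.
  by apply: (mulgI (f x)); rewrite -gmulfM !mulVKg.
by rewrite fVM !(nth_map 1%g) ?sk// ltnW.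
Qed.

Lemma bar_map0 (G H : groupType) (f g : {multiplicative G -> H})
    (x : {freeg (0.-tuple G)}) : bar_map f x = bar_map g x.
Proof.
elim/freeg_ind: x => [|x y IHx IHy|c]; first by rewrite !raddf0.
  by rewrite !bar_mapB IHx IHy.
by rewrite !bar_map_basis (tuple0 (map_tuple f c)) (tuple0 (map_tuple g c)).
Qed.

(** The maximum over the possibly infinite set of cells exists because the
    diameters are bounded. *)
Lemma bounded_maximum (S : nat -> Prop) (m : nat) :
  (exists a, S a) -> (forall a, S a -> (a <= m)%N) ->
  exists2 d, is_maximum S d & (d <= m)%N.
Proof.
move=> exS leS; pose b a := `[< S a >].
have exb : exists a, b a by have [a Sa] := exS; exists a; apply/asboolP.
have leb a : b a -> (a <= m)%N by move/asboolP/leS.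
case: (ex_maxnP exb leb) => d /asboolP Sd maxd; exists d; last exact: leS.
by split=> // a Sa; apply: maxd; apply/asboolP.
Qed.

Section Homotopy.
Variables (G A : groupType) (i : {multiplicative G -> A}) (n : nat).
Variable P : {additive chains G -> chains A}.
Hypothesis cP : contraction i n P.

Let PB : {morph P : x y / x - y}.
Proof. exact: raddfB. Qed.

(** The null-homotopy of the trivial homomorphism in positive dimensions: its
    image consists of simplices with all vertices at the identity, and coning
    from the identity contracts them. Subtracting it from the null-homotopy of
    [i] gives a homotopy from the trivial homomorphism to [i]. *)
Definition trivial_cone (x : chains G) : chains A :=
  cone 1%g (push (trivial_hom G A) (posdim x)).

Lemma trivial_coneB : {morph trivial_cone : x y / x - y}.
Proof. by move=> x y; rewrite /trivial_cone posdimB pushB coneB. Qed.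

Lemma trivial_cone_descends : descends trivial_cone.
Proof.
apply: descendsP => [|g t]; first exact: trivial_coneB.
rewrite /trivial_cone /translate -push_posdim push_comp.
by rewrite (@eq_push _ _ _ (trivial_hom G A)).
Qed.

Lemma trivial_cone_null s :
  normalize (bdry (trivial_cone (basis s)) + trivial_cone (bdry (basis s))) =
  normalize (push (trivial_hom G A) (posdim (basis s))).
Proof.
have desc : descends (fun x => cone 1%g (push (trivial_hom G A) x)).
  apply: descendsP => [x y|g t]; first by rewrite pushB coneB.
  by rewrite /translate push_comp (@eq_push _ _ _ (trivial_hom G A)).
rewrite /trivial_cone normalizeD [X in _ + X](desc _ _ (posdim_bdry _)).
by rewrite -normalizeD bdry_cone push_bdry subrK.
Qed.

Definition bar_homotopy (k : nat) :
    {freeg (k.-tuple G)} -> {freeg (k.+1.-tuple A)} :=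
  freeg_lift (fun c => to_bar k.+1
    (P (of_bar (basis c)) - trivial_cone (of_bar (basis c)))).
HB.instance Definition _ k := GRing.Additive.on (@bar_homotopy k).

Lemma bar_homotopyB k : {morph @bar_homotopy k : x y / x - y}.
Proof. exact: raddfB. Qed.

Lemma bar_homotopyE k (x : {freeg (k.-tuple G)}) :
  bar_homotopy x = to_bar k.+1 (P (of_bar x) - trivial_cone (of_bar x)).
Proof.
elim/freeg_ind: x => [|x y IHx IHy|c].
- by rewrite /trivial_cone !raddf0 addr0 raddf0.
- rewrite bar_homotopyB IHx IHy of_barB PB trivial_coneB -to_barB.
  by congr (to_bar _ _); freeg_abel.
exact: freeg_lift_basis.
Qed.

Lemma bar_homotopy0 (x : {freeg (0.-tuple G)}) : bar_homotopy x = 0.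
Proof.
elim/freeg_ind: x => [|x y IHx IHy|c]; first by rewrite raddf0.
  by rewrite bar_homotopyB IHx IHy subrr.
rewrite bar_homotopyE of_bar_basis (tuple0 c) /= (contraction_small cP)//.
by rewrite /trivial_cone posdim_basis /= !raddf0 addr0 raddf0.
Qed.

Lemma bar_homotopy_bd k (x : {freeg (k.+1.-tuple G)}) : (k.+1 <= n)%N ->
  bar_homotopy (bar_bd x) + bar_bd (bar_homotopy x) =
  bar_map i x - bar_map (trivial_hom G A) x.
Proof.
move=> lt_kn; elim/freeg_ind: x => [|x y IHx IHy|c].
- by rewrite !raddf0 ?addr0 ?subr0.
- rewrite bar_bdB !bar_homotopyB bar_bdB addrACA -opprD IHx IHy !bar_mapB.
  by freeg_abel.
rewrite !bar_homotopyE to_bar_bdry.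
set Q := fun x => P x - trivial_cone x.
have QB : {morph Q : x y / x - y}.
  by move=> x y; rewrite /Q PB trivial_coneB; freeg_abel.
have Qdesc : descends Q.
  move=> x y xy; rewrite /Q !normalizeB (contraction_descends cP xy).
  congr (_ - _).
  exact: trivial_cone_descends.
rewrite -/(Q _) -/(Q (of_bar (basis c))) -to_bar_normalize.
rewrite (Qdesc _ _ (of_bar_bdry _)) to_bar_normalize addrC -raddfD /=.
rewrite -(to_bar_map i) -(to_bar_map (trivial_hom G A)) -to_barB.
rewrite -to_bar_normalize -[in RHS]to_bar_normalize; congr (to_bar _ _).
rewrite of_bar_basis; move: (_ :: _) (size_path c) => s sk.
have posdim_s : posdim (basis s) = basis s by rewrite posdim_basis sk.
have -> : bdry (Q (basis s)) + Q (bdry (basis s)) =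
    (bdry (P (basis s)) + P (bdry (basis s))) -
    (bdry (trivial_cone (basis s)) + trivial_cone (bdry (basis s))).
  by rewrite /Q bdryB; freeg_abel.
rewrite normalizeB (contraction_null cP) ?sk// trivial_cone_null -normalizeB.
by rewrite posdim_s.
Qed.

Lemma bounded_bar_homotopy k (c : k.-tuple G) :
  (diameter (bar_homotopy (basis c)) <= control k.+1 + (0 < k))%N.
Proof.
case: k c => [|k] c; first by rewrite bar_homotopy0 /diameter dom0 big_nil.
apply: (@diameter_bounded _ predT); rewrite bar_homotopyE of_bar_basis.
move: (_ :: _) (size_path c) => s sk.
rewrite -[X in bounded _ X]muln1.
apply: (@bounded_image _ _ (fun u => size u == (size s).+1)) => [u _|] /=.
  rewrite /to_bar freeg_lift_basis; case: ifP => _; last by constructor.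
  exact: bounded_basis.
apply: bounded_add; first by have := contraction_bounded cP s; rewrite sk.
apply: bounded_opp; rewrite /trivial_cone posdim_basis sk /=.
rewrite push_basis cone_basis.
by apply: bounded_basis; rewrite /= size_map sk.
Qed.

Definition bar_partial_homotopy :
  partial_homotopy (ZB_map (trivial_hom G A)) (ZB_map i) n.
Proof.
apply: (@PartialHomotopy (ZB G) (ZB A) _ _ n
  (fun k _ => @bar_homotopy k : {additive _ -> _})) => [le0n x|k lekn ltkn x].
  by rewrite /= bar_homotopy0 raddf0 (bar_map0 i (trivial_hom G A)) subrr.
exact: bar_homotopy_bd.
Defined.
End Homotopy.

Local Close Scope ring_scope.

(** * The theorem *)

(** From dimension five on, a sum of all earlier bounds is taken so that the
    function dominates the bounds in every smaller dimension. *)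
Definition delta_BDH (k : nat) : nat :=
  match k with
  | 0 => 0
  | 1 => 6
  | 2 => 26
  | 3 => 186
  | 4 => 3410
  | _ => 3410 + \sum_(j < k.+1) (control j.+1).+1
  end.

Lemma control_values :
  [/\ control 1 = 0, control 2 = 3, control 3 = 16, control 4 = 97
    & control 5 = 706].
Proof.
have E k : 1 < k ->
    control k = (2 ^ k).-1 + \sum_(j < k) control j * 'C(k, j).
  by move=> lt1k; rewrite controlE /controlled_step leqNgt lt1k.
have c0 : control 0 = 0 by [].
have c1 : control 1 = 0 by [].
have c2 : control 2 = 3 by rewrite E// !big_ord_recr big_ord0 /= c0 c1.
have c3 : control 3 = 16 by rewrite E// !big_ord_recr big_ord0 /= c0 c1 c2.
have c4 : control 4 = 97 by rewrite E// !big_ord_recr big_ord0 /= c0 c1 c2 c3.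
by split=> //; rewrite E// !big_ord_recr big_ord0 /= c0 c1 c2 c3 c4.
Qed.

Lemma delta_BDH_bound j k : j <= k ->
  control j.+1 + (0 < j) <= delta_BDH k.
Proof.
have [c1 c2 c3 c4 c5] := control_values.
case: k => [|[|[|[|[|k]]]]]; rewrite /delta_BDH.
1-5: by case: j => [|[|[|[|[|j]]]]] //; rewrite ?c1 ?c2 ?c3 ?c4 ?c5.
move=> le_jk; rewrite -ltnS in le_jk.
rewrite (bigD1 (Ordinal le_jk)) //= addnCA; apply: leq_trans (leq_addr _ _).
by rewrite -[X in _ <= X]addn1 leq_add2l; case: (0 < j).
Qed.

Theorem theorem5p2 :
  exists delta : nat -> nat,
    (forall n : nat,
       exists Phi : forall G : groupType,
           partial_homotopy (ZB_map (trivial_hom G (Agroup n G)))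
                            (ZB_map (imap n G)) n,
         uniformly_controlled Phi delta) /\
    [/\ delta 0 = 0, delta 1 = 6, delta 2 = 26, delta 3 = 186
      & delta 4 = 3410].
Proof.
exists delta_BDH; split=> // n.
exists (fun G => bar_partial_homotopy (svalP (imap_contraction n G))).
move=> G k le_kn.
apply: bounded_maximum => [|_ [j [lejn [c [lejk ->]]]]].
  by eexists; exists 0, (leq0n n), [tuple].
have le_c := bounded_bar_homotopy (svalP (imap_contraction n G)) c.
exact: leq_trans le_c (delta_BDH_bound lejk).
Qed.
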